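(* For each dimension $n\ge 2$ there is a function $f:(0,\infty]\times[0,\infty)\to(0,\infty)$, depending only on $n$ and decreasing in the second variable, such that if $M$ is a properly convex projective $n$-manifold and $p,q$ are two points in $M$, then $\operatorname{inj}(q)>f(\operatorname{inj}(p),d_M(p,q))$.
   Context: A subset of $\mathbb{RP}^n$ is properly convex if every line meets it in a connected set and its closure is contained in an affine patch (complement of a hyperplane). A properly convex projective $n$-manifold is $M=\Omega/\Gamma$ with $\Omega\subset\mathbb{RP}^n$ nonempty, open, properly convex and $\Gamma$ a discrete torsion-free group of projective transformations preserving $\Omega$. $d_M$ is the Hilbert metric on $M$, induced from $d_\Omega(a,b)=\log\frac{\|b-x\|\|a-y\|}{\|b-y\|\|a-x\|}$, where $x,y\in\partial\overline\Omega$ are the endpoints of the segment through $a,b$ ($a$ between $x$ and $b$). $\operatorname{inj}(x)$ is the supremum of the radii of embedded metric balls in $M$ centered at $x$ (it is $\infty$ if $\Gamma$ is trivial). *)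

(* Defs.v *)
From HB Require Import structures.
From mathcomp Require Import all_boot all_order all_algebra.
From mathcomp Require Import all_classical all_reals all_analysis.
Set Implicit Arguments.
Unset Strict Implicit.
Unset Printing Implicit Defensive.
Import Order.TTheory GRing.Theory Num.Theory.
Import numFieldNormedType.Exports.
Local Open Scope classical_set_scope.
Local Open Scope quotient_scope.
Local Open Scope ring_scope.

Section ProjectiveSpace.
Variables (R : realType) (n : nat).

Notation nonzero_vec := (set_type [set v : 'rV[R]_n.+1 | v != 0]).

Definition proportional (u v : nonzero_vec) : bool :=
  `[< exists2 c : R, c != 0 & sval v = c *: sval u >].

Lemma proportional_refl : reflexive proportional.
Proof. by move=> u; apply/asboolP; exists 1; rewrite ?oner_neq0 ?scale1r. Qed.

Lemma proportional_sym : symmetric proportional.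
Proof.
suff H u v : proportional u v -> proportional v u
  by move=> u v; apply/idP/idP; apply: H.
move=> /asboolP[c c0 vE]; apply/asboolP; exists c^-1; first by rewrite invr_eq0.
by rewrite vE scalerA mulVf ?scale1r.
Qed.

Lemma proportional_trans : transitive proportional.
Proof.
move=> v u w /asboolP[c c0 vE] /asboolP[d d0 wE]; apply/asboolP.
by exists (d * c); rewrite ?mulf_neq0 // wE vE scalerA.
Qed.

Canonical proportional_equiv := EquivRel proportional
  proportional_refl proportional_sym proportional_trans.

(* RP^n, with the quotient topology of R^(n+1) \ {0}. *)
Definition RP : Type := quotient_topology {eq_quot proportional}.

HB.instance Definition _ := Topological.on RP.
HB.instance Definition _ := Quotient.on RP.

Definition rep (x : RP) : 'rV[R]_n.+1 := sval (repr x).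

Definition hyperplane (phi : 'cV[R]_n.+1) : set RP :=
  [set x | rep x *m phi = 0].

Definition affine_patch (phi : 'cV[R]_n.+1) : set RP := ~` hyperplane phi.

(* Identifies affine_patch phi with the affine hyperplane { v | v *m phi = 1 };
   the result does not depend on the representative. *)
Definition chart (phi : 'cV[R]_n.+1) (x : RP) : 'rV[R]_n.+1 :=
  ((rep x *m phi) 0 0)^-1 *: rep x.

(* The line spanned by the rows of L, a projective line when L has rank 2. *)
Definition proj_line (L : 'M[R]_(2, n.+1)) : set RP :=
  [set x | (rep x <= L)%MS].

Definition properly_convex (Om : set RP) : Prop :=
  (forall L : 'M[R]_(2, n.+1), \rank L = 2%N -> connected (proj_line L `&` Om))
  /\ (exists2 phi : 'cV[R]_n.+1, phi != 0 & closure Om `<=` affine_patch phi).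

Definition boundary (A : set RP) : set RP := closure A `\` interior A.

Definition between (u v w : 'rV[R]_n.+1) : Prop :=
  exists t : R, [/\ 0 <= t, t <= 1 & v = (1 - t) *: u + t *: w].

(* The norms are taken in any affine patch containing the closure of Om. The
   ratios are ratios of lengths along one line, so neither the patch nor the
   norm (here the sup norm of the library) matters. When a = b, x and y may be
   any boundary points and the formula gives ln 1 = 0. Outside of a properly
   convex open Om the value is meaningless. *)
Definition hilbert_dist (Om : set RP) (a b : RP) : R :=
  get [set r : R | exists phi : 'cV[R]_n.+1, exists x y : RP,
    [/\ phi != 0 /\ closure Om `<=` affine_patch phi,
        boundary (closure Om) x /\ boundary (closure Om) y,
        between (chart phi x) (chart phi a) (chart phi b),
        between (chart phi a) (chart phi b) (chart phi y)
      & r = ln ((`|chart phi b - chart phi x| * `|chart phi a - chart phi y|)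
              / (`|chart phi b - chart phi y| * `|chart phi a - chart phi x|))]].

Definition induces (A : 'M[R]_n.+1) (g : RP -> RP) : Prop :=
  forall v w : nonzero_vec, sval w = sval v *m A -> g (\pi_RP v) = \pi_RP w.

Definition proj_transformation (g : RP -> RP) : Prop :=
  exists2 A : 'M[R]_n.+1, A \in unitmx & induces A g.

(* The open sets of PGL(n+1,R), as the quotient of GL(n+1,R); the latter is
   open in the space of all matrices. *)
Definition pgl_open (W : set (RP -> RP)) : Prop :=
  open [set A : 'M[R]_n.+1 | A \in unitmx /\ (exists2 g, W g & induces A g)].

Record projective_group (Ga : set (RP -> RP)) : Prop := ProjectiveGroup {
  pg_transformation : forall g, Ga g -> proj_transformation g;
  pg_id : Ga id;
  pg_comp : forall g h, Ga g -> Ga h -> Ga (g \o h);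
  pg_inv : forall g, Ga g -> exists h, [/\ Ga h, cancel g h & cancel h g] }.

Definition discrete_group (Ga : set (RP -> RP)) : Prop :=
  forall g, Ga g -> exists2 W, pgl_open W & W `&` Ga = [set g].

Definition torsion_free (Ga : set (RP -> RP)) : Prop :=
  forall g (k : nat), Ga g -> (0 < k)%N -> iter k g =1 id -> g =1 id.

(* M = Om / Ga. *)
Record properly_convex_manifold (Om : set RP) (Ga : set (RP -> RP)) : Prop :=
  ProperlyConvexManifold {
  pcm_nonempty : Om !=set0;
  pcm_open : open Om;
  pcm_convex : properly_convex Om;
  pcm_group : projective_group Ga;
  pcm_discrete : discrete_group Ga;
  pcm_torsion_free : torsion_free Ga;
  pcm_preserves : forall g, Ga g -> g @` Om = Om }.

Definition orbit (Ga : set (RP -> RP)) (x : RP) : set RP :=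
  [set g x | g in Ga].

(* The points of Om / Ga are the orbits in Om. *)
Definition quotient_points (Om : set RP) (Ga : set (RP -> RP)) : set (set RP) :=
  [set orbit Ga x | x in Om].

(* The quotient metric; it does not mention Ga since p and q are orbits. *)
Definition quotient_dist (Om : set RP) (p q : set RP) : R :=
  inf [set hilbert_dist Om a b | a in p & b in q].

Definition hilbert_ball (Om : set RP) (x : RP) (r : R) : set RP :=
  [set y | Om y /\ hilbert_dist Om x y < r].

(* The metric r-ball of Om / Ga centered at p is the image of the r-ball of Om
   centered at any lift x of p; it is embedded when the projection
   Om -> Om / Ga, a covering map, is injective on that ball. *)
Definition embedded_ball (Om : set RP) (Ga : set (RP -> RP))
    (p : set RP) (r : R) : Prop :=
  forall x, p x -> set_inj (hilbert_ball Om x r) (orbit Ga).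

Definition inj_radius (Om : set RP) (Ga : set (RP -> RP)) (p : set RP) :
    \bar R :=
  ereal_sup [set r%:E | r in [set r : R | 0 < r /\ embedded_ball Om Ga p r]].

End ProjectiveSpace.

(* Main.v *)
(* Let C be the open cone over Om in R^(n+1). The Hilbert distance of [u] and [v]
   is ln (l k) for the least l, k with u <= l v and v <= k u in the order defined
   by C; this gives the metric axioms and the invariance under Ga.

   A ball of radius D is an order interval up to the factor exp D, and in an
   order interval the number of points that are pairwise e-apart is bounded in
   terms of n, D and e only (Auerbach's lemma and a grid). If a nontrivial g moves
   a lift x of q by very little, then many iterates of g move a fixed lift a of p,
   at distance about d(p, q) from x, to points of one ball around x. Two of these
   are closer than the injectivity radius at p, so a power of g fixes a. As Ga
   acts freely (stabilisers are finite by discreteness, hence trivial by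
   torsion-freeness), that power is trivial, a contradiction. *)

Require Import Defs.
From mathcomp Require Import all_boot all_order all_algebra.
From mathcomp Require Import all_classical all_reals all_analysis.
From mathcomp Require Import ring lra.
Set Implicit Arguments.
Unset Strict Implicit.
Unset Printing Implicit Defensive.
Import Order.TTheory GRing.Theory Num.Theory.
Import numFieldNormedType.Exports.
Local Open Scope classical_set_scope.
Local Open Scope ring_scope.

(** * Auerbach's lemma and the pigeonhole principle on a grid *)

(** The constant must not see the shape of [Om], so points of a ball cannot be counted in
    coordinates fixed beforehand. The coordinates are taken from the counted points themselves, and
    the estimates are inequalities in the order of the cone. Proper discontinuity is different: its
    constants may depend on [Om] and on the point, so it is proved with ordinary matrix entries and
    the sup norm. Distances are accessed through statements [d < r], because the cone is open and
    the least factors l and k are not attained in it. As [f] is controlled only for a positive first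
    argument, the positivity of inj(p) is itself part of the proof. *)

Lemma det_replace_row (F : fieldType) (r : nat) (D : 'M[F]_r) (v : 'rV[F]_r)
    (k : 'I_r) : D \in unitmx ->
  (v *m invmx D) 0 k =
    \det (\matrix_(a, b) (if a == k then v 0 b else D a b)) / \det D.
Proof.
move=> Du; rewrite /invmx Du -scalemxAr mxE mulrC; congr (_ / _).
set D' := \matrix_(a, b) _.
rewrite (expand_det_row D' k) mxE; apply: eq_bigr => l _.
rewrite !mxE eqxx; congr (_ * _); rewrite /cofactor; congr (_ * \det _).
by apply/matrixP => a b; rewrite !mxE -val_eqE /= eq_sym (negbTE (neq_bump _ _)).
Qed.

(* Auerbach's lemma for a finite family: maximise a minor, then use Cramer. *)
Lemma bounded_combination (F : realFieldType) (N m : nat) (W : 'M[F]_(N, m)) :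
  exists r (f : 'I_r -> 'I_N) (c : 'M[F]_(N, r)),
    [/\ (r <= m)%N, W = c *m rowsub f W & forall i k, `|c i k| <= 1].
Proof.
have := col_base_full W; have := mulmx_base W.
move: (rank_leq_col W) (col_base W) (row_base W); move: (\rank W) => r rm B Q BQ Bf.
(* [B] has full column rank, so some maximal minor is nonzero. Maps that repeat a row give 0, so the
   maximum over all maps is an invertible minor. *)
pose f0 : {ffun 'I_r -> 'I_N} := finfun (fullrankfun Bf).
pose f := [arg max_(g > f0) `|\det (rowsub g B)|]%O.
have f0u : rowsub f0 B \in unitmx.
  rewrite (_ : rowsub f0 B = rowsub (fullrankfun Bf) B) ?fullrowsub_unit //.
  by apply: eq_rowsub => i; rewrite ffunE.
have fmax (g : {ffun 'I_r -> 'I_N}) : `|\det (rowsub g B)| <= `|\det (rowsub f B)|.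
  by rewrite /f; case: arg_maxP => // h _; apply.
have fu : rowsub f B \in unitmx.
  move: f0u; rewrite !unitmxE !unitfE -!normr_gt0 => /lt_le_trans; apply.
  exact: fmax.
exists r, f, (B *m invmx (rowsub f B)); split=> //.
  have -> : rowsub f W = rowsub f B *m Q by rewrite -BQ rowsubE mulmxA -rowsubE.
  by rewrite mulmxA mulmxKV ?BQ.
move=> i k.
have -> : (B *m invmx (rowsub f B)) i k = (row i B *m invmx (rowsub f B)) 0 k.
  by rewrite -row_mul [RHS]mxE.
rewrite det_replace_row // normrM normfV ler_pdivrMr ?mul1r; last first.
  by rewrite normr_gt0 -unitfE -unitmxE.
(* Cramer's numerator is the minor with row [i] in place of row [f k], one of the competitors. *)
have := fmax [ffun a => if a == k then i else f a].
congr (`|\det _| <= _); apply/matrixP => a b; rewrite !mxE ffunE.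
by case: ifP => _; rewrite ?mxE.
Qed.

(* The values are rounded to the cells of a grid of width 2 / M. *)
Lemma grid_pigeonhole (R : archiRealFieldType) (T : finType) (N M : nat)
    (c : 'I_N -> T -> R) : (0 < M)%N -> (M.+1 ^ #|T| < N)%N ->
    (forall i t, `|c i t| <= 1) ->
  exists i j : 'I_N, (i < j)%N /\ forall t, `|c i t - c j t| <= 2 / M%:R.
Proof.
move=> M0 NM c1; have Mr : 0 < M%:R :> R by rewrite ltr0n.
pose cell i t := Num.truncn ((c i t + 1) * (M%:R / 2)).
have cnn i t : 0 <= (c i t + 1) * (M%:R / 2).
  by have := c1 i t; rewrite ler_norml => /andP[? _]; rewrite mulr_ge0 //; lra.
(* The value 1 falls into cell [M], hence M + 1 cells per coordinate. *)
have cell_lt i t : (cell i t < M.+1)%N.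
  rewrite ltnS truncn_le_nat.
  have := c1 i t; rewrite ler_norml => /andP[_ h].
  suff : (c i t + 1) * (M%:R / 2) <= M%:R by rewrite -natr1; lra.
  have : c i t + 1 <= 2 by lra.
  move=> /(ler_wpM2r (ltW (divr_gt0 Mr (ltr0n R 2)))) /le_trans; apply; lra.
pose h (i : 'I_N) : {ffun T -> 'I_M.+1} := [ffun t => Ordinal (cell_lt i t)].
have /injectivePn[i [j ij hij]] : ~~ injectiveb h.
  apply/injectiveP => /leq_card; rewrite card_ffun !card_ord leqNgt.
  by rewrite NM.
wlog lij : i j ij hij / (i < j)%N.
  move=> H; move: (ij); rewrite -val_eqE neq_ltn => /orP[l|l]; first exact: (H i j).
  by apply: (H j i) => //; rewrite eq_sym.
exists i, j; split=> // t; move/ffunP/(_ t): hij; rewrite !ffunE => -[] E.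
have := truncn_itv (cnn i t); have := truncn_itv (cnn j t).
rewrite -!/(cell _ _) E -[(cell j t).+1%:R]natr1 => /andP[a1 a2] /andP[b1 b2].
have : `|(c i t - c j t) * (M%:R / 2)| <= 1.
  rewrite ler_norml; apply/andP; split; lra.
rewrite normrM [`|M%:R / 2|]gtr0_norm ?divr_gt0 // => K.
by rewrite ler_pdivlMr //; lra.
Qed.

(** * Open proper cones and their Hilbert metric *)

(** [cone_ray] encodes properness: a section of [C] by a level set of [phi] contains no ray. The
    other fields alone would admit the half-space where [phi] is positive. *)
Record is_cone (R : realType) (m : nat) (phi : 'cV[R]_m.+1)
    (C : set 'rV[R]_m.+1) : Prop := IsCone {
  coneD : forall u v, C u -> C v -> C (u + v);
  coneZ : forall t u, 0 < t -> C u -> C (t *: u);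
  cone_open : open C;
  cone_pos : forall u, C u -> 0 < (u *m phi) 0 0;
  cone_ray : forall u w, C u -> w != 0 -> (w *m phi) 0 0 = 0 ->
    exists2 t, 0 < t & ~ C (u + t *: w) }.

(* [hilbert_lt C u v r] says that d([u], [v]) < r for the Hilbert metric d of
   the projectivisation of C: the cross ratio is the product of the least l and
   k with u <= l v and v <= k u in the order defined by C. *)
Definition hilbert_lt (R : realType) (m : nat) (C : set 'rV[R]_m)
    (u v : 'rV[R]_m) (r : R) : Prop :=
  exists l k, [/\ C (l *: v - u), C (k *: u - v) & l * k < expR r].

Section Cones.
Variables (R : realType) (m : nat) (phi : 'cV[R]_m.+1) (C : set 'rV[R]_m.+1).
Hypothesis hC : is_cone phi C.
Implicit Types u v w p q : 'rV[R]_m.+1.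

Lemma evD u v : ((u + v) *m phi) 0 0 = (u *m phi) 0 0 + (v *m phi) 0 0.
Proof. by rewrite mulmxDl mxE. Qed.

Lemma evB u v : ((u - v) *m phi) 0 0 = (u *m phi) 0 0 - (v *m phi) 0 0.
Proof. by rewrite mulmxBl !mxE. Qed.

Lemma evZ t u : ((t *: u) *m phi) 0 0 = t * (u *m phi) 0 0.
Proof. by rewrite -scalemxAl mxE. Qed.

Lemma cone_neq0 u : C u -> u != 0.
Proof.
by move=> /(cone_pos hC); apply: contraTneq => ->; rewrite mul0mx mxE ltxx.
Qed.

Lemma cone_addZ t u v : 0 <= t -> C u -> C v -> C (u + t *: v).
Proof.
rewrite le_eqVlt => /orP[/eqP<-|t0] Cu Cv; first by rewrite scale0r addr0.
by apply: (coneD hC) => //; apply: (coneZ hC).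
Qed.

Lemma cone_ball u : C u ->
  exists2 e : R, 0 < e & forall w, `|w| < e -> C (u + w).
Proof.
move=> Cu; have /nbhs_ballP[e /= e0 He] : nbhs u C.
  by apply: open_nbhs_nbhs; split => //; exact: (cone_open hC).
exists e => // w we; apply: He; rewrite -ball_normE /=.
by rewrite opprD addrA subrr add0r normrN.
Qed.

(** [z] is approached by points of [C], and the error is absorbed by [u], around which [C] contains
    a ball. *)
Lemma cone_closureD z u : closure C z -> C u -> C (z + u).
Proof.
move=> Cz /cone_ball[e e0 He].
have [z' [Cz' zz']] := Cz _ (nbhsx_ballx z e e0).
rewrite (_ : z + u = z' + (u + (z - z'))); last by rewrite addrCA subrKC addrC.
by apply: (coneD hC) => //; apply: He; move: zz'; rewrite -ball_normE.
Qed.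

Lemma cone_no_line u w : C u -> w != 0 ->
  exists2 t, 0 < t & ~ (C (u + t *: w) /\ C (u - t *: w)).
Proof.
move=> Cu w0; have u0 := cone_pos hC Cu.
have [e0|e0] := eqVneq ((w *m phi) 0 0) 0.
  by have [t t0 nC] := cone_ray hC Cu w0 e0; exists t => // -[].
exists ((u *m phi) 0 0 / `|(w *m phi) 0 0|); first by rewrite divr_gt0 ?normr_gt0.
move=> [/(cone_pos hC) + /(cone_pos hC)]; rewrite evD evB evZ.
have [E|E] := ler0P ((w *m phi) 0 0).
  by rewrite invrN mulrN mulNr divfK // subrr ltxx.
by rewrite divfK // subrr ltxx.
Qed.

Lemma order_interval_scale p w s t : 0 < s -> s <= t -> C p ->
  C (p + t *: w) -> C (p + s *: w).
Proof.
move=> s0 st Cp Ct; have t0 := lt_le_trans s0 st.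
rewrite (_ : p + s *: w = (s / t) *: (p + t *: w) + (1 - s / t) *: p).
  apply: cone_addZ => //; first by rewrite subr_ge0 ler_pdivrMr ?mul1r.
  by apply: (coneZ hC) => //; rewrite divr_gt0.
by apply/rowP => i; rewrite !mxE; field; rewrite gt_eqF.
Qed.

(* Otherwise, by compactness of the unit sphere, the interval would contain a
   line through the origin. *)
Lemma order_interval_bounded p : C p ->
  exists2 B : R, 0 < B & forall w, C (p + w) -> C (p - w) -> `|w| <= B.
Proof.
move=> Cp.
pose S : set 'rV[R]_m.+1 := [set s | `|s| = 1].
have cS : compact S.
  apply: bounded_closed_compact.
    by exists 1; split; [exact: num_real|move=> x x1 s /= ->; exact: ltW].
  rewrite (_ : S = Num.norm @^-1` [set 1]) //.
  apply: preimage_closed; last exact: closed_eq.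
  by move=> x _; apply: norm_continuous.
pose P (t : R) s := ~ (C (p + t *: s) /\ C (p - t *: s)).
have /compact_near_coveringP/(_ R (+oo%R : set_system R) P) := cS.
case.
  move=> s; rewrite /S /= => s1.
  have s0 : s != 0 by rewrite -normr_gt0 s1.
  have [t t0 nC] := cone_no_line Cp s0.
  have [e e0 He] := cone_ball Cp.
  (* Parameters beyond [2 * t] leave room for turning the direction: averaging [p + (2 * t) *: s']
     with a point of the ball around [p] reaches [p + t *: s]. *)
  exists (ball s (e / (2 * t)), [set x | 2 * t < x]) => /=.
    split; first by apply: nbhsx_ballx; rewrite divr_gt0 // mulr_gt0.
    by exists (2 * t); split => //; exact: num_real.
  move=> [s' x] /= [ss' xt] [C1 C2]; apply: nC.
  have ht : 0 < 2 * t by rewrite mulr_gt0.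
  move: C1 => /(order_interval_scale ht (ltW xt) Cp) C1.
  move: C2; rewrite -scalerN => /(order_interval_scale ht (ltW xt) Cp) C2.
  have key a : `|a| < e -> forall b, C (p + (2 * t) *: b) ->
      C (p + t *: b + 2^-1 *: a).
    move=> ae b Cb.
    rewrite (_ : _ + _ = 2^-1 *: ((p + (2 * t) *: b) + (p + a))).
      by apply: (coneZ hC); rewrite ?invr_gt0 //; apply: (coneD hC); auto.
    by apply/rowP => i; rewrite !mxE; field.
  have nss : `|(2 * t) *: (s - s')| < e.
    rewrite normrZ gtr0_norm // -ltr_pdivlMl // mulrC.
    by move: ss'; rewrite -ball_normE.
  split.
    have := key _ nss _ C1; congr C.
    by apply/rowP => i; rewrite !mxE; field.
  move: nss; rewrite -normrN => nss.
  have := key _ nss _ C2; congr C.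
  by apply/rowP => i; rewrite !mxE; field.
move=> B [_ HB].
have B0 : 0 <= Num.max B 0 by rewrite le_max lexx orbT.
have BB : B <= Num.max B 0 by rewrite le_max lexx.
exists (Num.max B 0 + 1) => [|w C1 C2]; first by lra.
rewrite leNgt; apply/negP => Bw.
have w0 : 0 < `|w| by lra.
have wE : `|w| *: (`|w|^-1 *: w) = w by rewrite scalerA divff ?scale1r // gt_eqF.
have BBw : B < `|w| by lra.
apply: (HB _ BBw (`|w|^-1 *: w)); last by rewrite wE.
by rewrite /S /= normrZ normfV normr_id mulVf // gt_eqF.
Qed.
End Cones.

(** * Metric axioms and packing in terms of the cone order *)

Section ConeMetric.
Variables (R : realType) (m : nat) (phi : 'cV[R]_m.+1) (C : set 'rV[R]_m.+1).
Hypothesis hC : is_cone phi C.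
Implicit Types u v w p q : 'rV[R]_m.+1.

Lemma dominating_gt0 l u v : C u -> C v -> C (l *: v - u) -> 0 < l.
Proof.
move=> /(cone_pos hC) u0 /(cone_pos hC) v0 /(cone_pos hC).
rewrite evB evZ => h; rewrite -(pmulr_lgt0 _ v0); lra.
Qed.

Lemma hilbert_lt_sym u v r : hilbert_lt C u v r -> hilbert_lt C v u r.
Proof. by move=> [l [k [h1 h2 h3]]]; exists k, l; rewrite mulrC. Qed.

Lemma hilbert_lt_trans u v w r s : C u -> C v -> C w ->
  hilbert_lt C u v r -> hilbert_lt C v w s -> hilbert_lt C u w (r + s).
Proof.
move=> Cu Cv Cw [l [k [h1 h2 h3]]] [l' [k' [h1' h2' h3']]].
have l0 := dominating_gt0 Cu Cv h1; have k0 := dominating_gt0 Cv Cu h2.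
have l0' := dominating_gt0 Cv Cw h1'; have k0' := dominating_gt0 Cw Cv h2'.
exists (l * l'), (k' * k); split.
- rewrite (_ : _ - _ = (l *: v - u) + l *: (l' *: w - v)).
    by apply: (cone_addZ hC) => //; exact: ltW.
  by apply/rowP => i; rewrite !mxE; ring.
- rewrite (_ : _ - _ = (k' *: v - w) + k' *: (k *: u - v)).
    by apply: (cone_addZ hC) => //; exact: ltW.
  by apply/rowP => i; rewrite !mxE; ring.
- rewrite expRD (_ : _ * _ * _ = (l * k) * (l' * k')); last by ring.
  exact: ltr_pM (ltW (mulr_gt0 l0 k0)) (ltW (mulr_gt0 l0' k0')) h3 h3'.
Qed.

Lemma hilbert_lt_scale a b u v r : 0 < a -> 0 < b ->
  hilbert_lt C u v r -> hilbert_lt C (a *: u) (b *: v) r.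
Proof.
move=> a0 b0 [l [k [h1 h2 h3]]]; exists (l * a / b), (k * b / a); split.
- rewrite scalerA divfK ?gt_eqF // mulrC -scalerA -scalerBr.
  exact: (coneZ hC).
- rewrite scalerA divfK ?gt_eqF // mulrC -scalerA -scalerBr.
  exact: (coneZ hC).
- by rewrite (_ : _ * _ = l * k) //; field; rewrite !gt_eqF.
Qed.

Lemma hilbert_lt_map (A : 'M[R]_m.+1) u v r : (forall w, C w -> C (w *m A)) ->
  hilbert_lt C u v r -> hilbert_lt C (u *m A) (v *m A) r.
Proof.
move=> CA [l [k [h1 h2 h3]]]; exists l, k.
by split=> //; rewrite scalemxAl -mulmxBl; apply: CA.
Qed.

Lemma hilbert_lt_gt0 u v r : C u -> C v -> hilbert_lt C u v r -> 0 < r.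
Proof.
move=> Cu Cv [l [k [h1 h2 h3]]].
have l0 := dominating_gt0 Cu Cv h1; have k0 := dominating_gt0 Cv Cu h2.
have u0 := cone_pos hC Cu.
move: h1 h2 => /(cone_pos hC) + /(cone_pos hC); rewrite !evB !evZ.
rewrite !subr_gt0 => h1 h2.
have : (u *m phi) 0 0 < l * k * (u *m phi) 0 0.
  by apply: (lt_trans h1); rewrite -mulrA ltr_pM2l.
by rewrite -ltr_pdivrMr // divff ?gt_eqF // => /lt_trans/(_ h3); rewrite expR_gt1.
Qed.

Lemma hilbert_lt_of_dominating l r u v :
  C (l *: v - u) -> C (l *: u - v) -> l ^+ 2 < expR r -> hilbert_lt C u v r.
Proof. by move=> h1 h2 h3; exists l, l. Qed.

Lemma hilbert_lt_refl u r : C u -> 0 < r -> hilbert_lt C u u r.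
Proof.
move=> Cu r0; have e1 : 1 < expR (r / 3) by rewrite expR_gt1; lra.
have Ce : C (expR (r / 3) *: u - u).
  by rewrite -{2}[u]scale1r -scalerBl; apply: (coneZ hC); rewrite ?subr_gt0.
apply: (hilbert_lt_of_dominating Ce Ce).
by rewrite expr2 -expRD ltr_expR; lra.
Qed.

(** Equal values of [phi] force [k > 1], so [l] alone is already below [l * k < expR r]. *)
Lemma hilbert_lt_dominating u v r : C u -> C v ->
  (u *m phi) 0 0 = (v *m phi) 0 0 -> hilbert_lt C u v r ->
  C (expR r *: v - u).
Proof.
move=> Cu Cv uv [l [k [h1 h2 h3]]].
have v0 := cone_pos hC Cv.
have l0 := dominating_gt0 Cu Cv h1.
have k1 : 1 < k.
  move: h2 => /(cone_pos hC); rewrite evB evZ uv subr_gt0 => h.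
  by rewrite -(ltr_pM2r v0) mul1r.
rewrite (_ : _ - _ = (l *: v - u) + (expR r - l) *: v).
  apply: (cone_addZ hC) => //; rewrite subr_ge0 ltW // (lt_trans _ h3) //.
  by rewrite ltr_pMr.
by apply/rowP => i; rewrite !mxE; ring.
Qed.

(** If [u] and [v] differed, the whole ray from [u] through [v] would stay in [C], against
    [cone_ray]: up to [v] by convexity, and beyond it because [l *: v] dominates [u] for every
    [l > 1]. *)
Lemma hilbert_lt_eq u v : C u -> C v -> (u *m phi) 0 0 = (v *m phi) 0 0 ->
  (forall r, 0 < r -> hilbert_lt C u v r) -> u = v.
Proof.
move=> Cu Cv uv uvr.
have dom l : 1 < l -> C (l *: v - u).
  move=> l1; have l0 : 0 < l by apply: lt_trans l1.
  rewrite -[l]lnK //; apply: hilbert_lt_dominating => //.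
  by apply: uvr; rewrite ln_gt0.
apply/eqP; rewrite eq_sym -subr_eq0; apply/negP => /negP vu0.
have [|t t0] := cone_ray hC Cu vu0; first by rewrite evB uv subrr.
case; have [t1|t1|->] := ltgtP t 1.
- rewrite (_ : _ + _ = (1 - t) *: u + t *: v).
    apply: (cone_addZ hC) => //; first exact: ltW.
    by apply: (coneZ hC) => //; rewrite subr_gt0.
  by apply/rowP => i; rewrite !mxE; ring.
- have t10 : 0 < t - 1 by rewrite subr_gt0.
  rewrite (_ : _ + _ = (t - 1) *: ((t / (t - 1)) *: v - u)).
    apply: (coneZ hC) => //; apply: dom; rewrite ltr_pdivlMr //; lra.
  by apply/rowP => i; rewrite !mxE; field; rewrite gt_eqF.
- by rewrite scale1r subrKC.
Qed.

(* By Auerbach's lemma all the points are combinations of at most m + 1 of them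
   with coefficients in [-1, 1], so the number N of points that forces two of
   them to be close depends only on m, E and M, not on the cone. *)
Lemma cone_packing (N M : nat) (E d : R) q (v : 'I_N -> 'rV[R]_m.+1) :
  (0 < M)%N -> (M.+1 ^ m.+1 < N)%N -> 0 < E -> C q -> (forall i, C (v i)) ->
  (forall i, C (E *: v i - q)) -> (forall i, C (E *: q - v i)) ->
  2 * m.+1%:R * E ^+ 2 / M%:R <= d ->
  exists i j : 'I_N, [/\ (i < j)%N, C ((1 + d) *: v j - v i)
    & C ((1 + d) *: v i - v j)].
Proof.
move=> M0 MN E0 Cq Cv Cvq Cqv hd.
pose W := \matrix_i v i.
have [r [f [c [rm WE c1]]]] := bounded_combination W.
have [|||i [j [ij cij]]] := @grid_pigeonhole R 'I_r N M c => //.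
  by rewrite card_ord (leq_ltn_trans _ MN) // leq_pexp2l.
have Mr : 0 < M%:R :> R by rewrite ltr0n.
have vE a : v a = \sum_k c a k *: v (f k).
  rewrite -[v a](rowK v) -/W {1}WE row_mul mulmx_sum_row.
  by apply: eq_bigr => k _; rewrite row_rowsub rowK mxE.
(* Zero is added to [C] as the neutral element for the induction over a sum. *)
pose C0 w := w = 0 \/ C w.
have C0D w w' : C0 w -> C0 w' -> C0 (w + w').
  move=> [->|Cw] [->|Cw']; rewrite ?add0r ?addr0; rewrite /C0; auto.
  by right; apply: (coneD hC).
have CC0 w w' : C w -> C0 w' -> C (w + w').
  by move=> Cw [->|Cw']; rewrite ?addr0 //; apply: (coneD hC).
have d0 : 0 < d by apply: lt_le_trans hd; rewrite !(mulr_gt0, invr_gt0, exprn_gt0).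
have key a b : (forall k, `|c a k - c b k| <= 2 / M%:R) ->
    C ((1 + d) *: v a - v b).
  move=> cab; pose e : R := 2 / M%:R.
  have e0 : 0 < e by rewrite divr_gt0.
  (* Each coefficient difference is at least [- e] and each [v (f k)] is below [E *: q], so each of
     the [r] terms costs at most [e * E] times [q]. *)
  have Cab : C0 ((r%:R * e * E) *: q + (v a - v b)).
    have -> : (r%:R * e * E) *: q + (v a - v b) =
        \sum_k ((e * E) *: q + (c a k - c b k) *: v (f k)).
      rewrite big_split sumr_const card_ord /= -[(_ *: q) *+ r]scaler_nat scalerA mulrA.
      congr (_ + _); rewrite {1}(vE a) {1}(vE b) -sumrB.
      by apply: eq_bigr => k _; rewrite scalerBl.
    apply: (big_ind C0); [by left|exact: C0D|move=> k _; right].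
    have := cab k; rewrite ler_norml => /andP[ck _].
    rewrite (_ : _ + _ = e *: (E *: q - v (f k))
        + (e + (c a k - c b k)) *: v (f k)).
      by apply: (cone_addZ hC) => //; [rewrite /e; lra|apply: (coneZ hC)].
    by apply/rowP => l; rewrite !mxE; ring.
  (* The cost in [q] is paid by [q <= E *: v a]. This gives the second factor [E], and [hd] with
     [r <= m + 1] says that [d] suffices. *)
  rewrite (_ : _ - _ = ((d / E) *: (E *: v a - q) + (d / E - r%:R * e * E) *: q)
      + ((r%:R * e * E) *: q + (v a - v b))).
    apply: CC0 => //; apply: (cone_addZ hC) => //; last first.
      by apply: (coneZ hC) => //; rewrite divr_gt0.
    rewrite subr_ge0 ler_pdivlMr //; apply: le_trans hd.
    have -> : r%:R * e * E * E = r%:R * (e * E ^+ 2) by ring.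
    have -> : 2 * m.+1%:R * E ^+ 2 / M%:R = m.+1%:R * (e * E ^+ 2).
      by rewrite /e [2 * m.+1%:R]mulrC; ring.
    by rewrite ler_wpM2r ?ler_nat // mulr_ge0 ?exprn_ge0 ?ltW.
  by apply/rowP => l; rewrite !mxE; field; rewrite gt_eqF.
exists i, j; split=> //; last exact: key.
by apply: key => k; rewrite distrC.
Qed.
End ConeMetric.

(** * Lifting from projective space *)

Definition lifts (R : realType) (n : nat) (v : 'rV[R]_n.+1) (x : RP R n) : Prop :=
  exists2 c : R, c != 0 & v = c *: rep x.

Section Lifts.
Local Open Scope quotient_scope.
Variables (R : realType) (n : nat).
Implicit Types (v w : 'rV[R]_n.+1) (x y : RP R n) (Om : set (RP R n)).

Let nonzero_vec := set_type [set v : 'rV[R]_n.+1 | v != 0].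

Let nonzero v (v0 : v != 0) : nonzero_vec := exist _ v (mem_set v0).

Lemma rep_neq0 x : rep x != 0.
Proof. exact: set_mem (svalP (repr x)). Qed.

Lemma lift_neq0 v x : lifts v x -> v != 0.
Proof. by move=> [c c0 ->]; rewrite scaler_eq0 negb_or c0 rep_neq0. Qed.

Lemma lift_rep x : lifts (rep x) x.
Proof. by exists 1; rewrite ?oner_neq0 ?scale1r. Qed.

Lemma lift_scale c v x : c != 0 -> lifts v x -> lifts (c *: v) x.
Proof.
by move=> c0 [d d0 ->]; exists (c * d); rewrite ?mulf_neq0 // scalerA.
Qed.

Let lift_pi (v : nonzero_vec) : lifts (sval v) (\pi_(RP R n) v).
Proof.
have /eqmodP/asboolP[c c0 E] : \pi_(RP R n) (repr (\pi_(RP R n) v)) = \pi v.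
  by rewrite reprK.
by exists c.
Qed.

Lemma lift_exists v : v != 0 -> exists x, lifts v x.
Proof.
by move=> v0; exists (\pi_(RP R n) (nonzero v0)); exact: (lift_pi (nonzero v0)).
Qed.

Lemma lift_inj v x y : lifts v x -> lifts v y -> x = y.
Proof.
move=> [c c0 ->] [d d0 E]; rewrite -[x]reprK -[y]reprK.
apply/eqmodP/asboolP; exists (d^-1 * c); first by rewrite mulf_neq0 ?invr_eq0.
by rewrite -scalerA [c *: _]E scalerA mulVf // scale1r.
Qed.

Lemma induces_lift (A : 'M[R]_n.+1) g v x : A \in unitmx -> induces A g ->
  lifts v x -> lifts (v *m A) (g x).
Proof.
move=> Au Ag [c c0 ->].
rewrite -scalemxAl; apply: lift_scale => //.
have rA0 : rep x *m A != 0.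
  by rewrite -(mul0mx _ A) (inj_eq (can_inj (mulmxK Au))) rep_neq0.
have -> : g x = \pi_(RP R n) (nonzero rA0) by rewrite -{1}[x]reprK; apply: Ag.
exact: (lift_pi (nonzero rA0)).
Qed.

Lemma induces_of_lift (A : 'M[R]_n.+1) (g : RP R n -> RP R n) :
  (forall v x, lifts v x -> lifts (v *m A) (g x)) -> induces A g.
Proof.
move=> H v w E; apply: lift_inj (lift_pi w); rewrite E; apply: H.
exact: lift_pi.
Qed.

Lemma open_lift Om : open Om -> open [set v | exists2 x, Om x & lifts v x].
Proof.
move=> oOm; have [U oU UE] : exists2 U : set 'rV[R]_n.+1, open U &
    set_val @^-1` U = \pi_(RP R n) @^-1` Om by exact: oOm.
have -> : [set v | exists2 x, Om x & lifts v x] = U `&` [set v | v != 0].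
  apply/seteqP; split=> v /=.
    move=> [x Omx vx]; have v0 := lift_neq0 vx; split=> //.
    have : ((\pi_(RP R n)) @^-1` Om) (nonzero v0).
      rewrite /preimage /= (_ : \pi_(RP R n) _ = x) //.
      by apply: lift_inj vx; exact: (lift_pi (nonzero v0)).
    by rewrite -UE.
  move=> [Uv v0]; have : (sval @^-1` U) (nonzero v0) by [].
  rewrite UE => Ov; exists (\pi_(RP R n) (nonzero v0)) => //.
  exact: (lift_pi (nonzero v0)).
apply: openI => //; rewrite (_ : mkset _ = ~` [set 0]).
  apply: closed_openC; apply: accessible_closed_set1.
  exact: hausdorff_accessible (@norm_hausdorff _ _).
by apply/seteqP; split=> v /= /eqP.
Qed.

Lemma open_of_lift (W : set 'rV[R]_n.+1) : open W ->
  (forall c v, c != 0 -> W v -> W (c *: v)) -> open [set x | W (rep x)].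
Proof.
move=> oW WZ; rewrite /open /= /quotient_open /open /=; exists W => //.
apply/seteqP; split=> v /= Wv.
  have [c c0 E] := lift_pi v.
  rewrite (_ : rep _ = c^-1 *: sval v); last by rewrite E scalerA mulVf ?scale1r.
  by apply: WZ; rewrite ?invr_eq0.
have [c c0 E] := lift_pi v.
by rewrite (_ : set_val v = sval v) // E; apply: WZ.
Qed.

(** The saturation of [W] under nonzero scalars is a union of open sets; thus the projection to [RP]
    is an open map. *)
Lemma open_of_lift_chart (W : set 'rV[R]_n.+1) : open W ->
  open [set x : RP R n | exists2 v, lifts v x & W v].
Proof.
move=> oW.
rewrite (_ : mkset _ =
   [set x | (\bigcup_(c in [set c : R | c != 0]) ( *:%R c @^-1` W)) (rep x)]).
  apply: open_of_lift.
    apply: bigcup_open => c _; apply: open_comp => // v _.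
    exact: scaler_continuous.
  move=> c v c0 [d /= d0 Wv]; exists (d / c); first by rewrite /= mulf_neq0 ?invr_eq0.
  by rewrite /preimage /= scalerA divfK.
apply/seteqP; split=> x /=.
  by move=> [v [c c0 ->] Wv]; exists c.
by move=> [c c0 Wv]; exists (c *: rep x) => //; exists c.
Qed.
End Lifts.

(** * The cone over a properly convex domain *)

(** When [phi] does not vanish on [Om], the lifts of [Om] form two opposite halves, and the sign of
    [phi] selects one. *)
Definition cone_over (R : realType) (n : nat) (Om : set (RP R n))
    (phi : 'cV[R]_n.+1) : set 'rV[R]_n.+1 :=
  [set v | (exists2 x, Om x & lifts v x) /\ 0 < (v *m phi) 0 0].

Lemma ev_continuous (R : realType) (m : nat) (phi : 'cV[R]_m.+1) :
  continuous (fun v : 'rV[R]_m.+1 => (v *m phi) 0 0).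
Proof.
rewrite (_ : (fun v => _) = (fun v : 'rV[R]_m.+1 => \sum_j v 0 j * phi j 0)).
  apply: continuous_big => [|j _ v]; first exact: add_continuous.
  by apply: continuousM; [exact: coord_continuous|exact: cst_continuous].
by apply/funext => w; rewrite mxE.
Qed.

Lemma open_ev_mul_gt0 (R : realType) (n : nat) (phi psi : 'cV[R]_n.+1) :
  open [set x : RP R n | 0 < (rep x *m psi) 0 0 * (rep x *m phi) 0 0].
Proof.
apply: (@open_of_lift R n
  [set v : 'rV[R]_n.+1 | 0 < (v *m psi) 0 0 * (v *m phi) 0 0]).
  apply: (@open_comp _ _ (fun v : 'rV[R]_n.+1 => (v *m psi) 0 0 * (v *m phi) 0 0)
    [set t | 0 < t]); last exact: open_gt.
  by move=> v _; apply: continuousM; apply: ev_continuous.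
move=> c v c0 /= h; rewrite !evZ mulrACA -expr2 pmulr_rgt0 //.
by rewrite exprn_even_gt0.
Qed.

(** If the form took both signs, a positive combination of two points would lie in its kernel. This
    fixes the sign when the affine patch is changed and when a matrix is chosen for a group
    element. *)
Lemma cone_sign (R : realType) (m : nat) (psi : 'cV[R]_m.+1)
    (C : set 'rV[R]_m.+1) :
  (forall u v, C u -> C v -> C (u + v)) ->
  (forall t u, 0 < t -> C u -> C (t *: u)) ->
  (forall u, C u -> (u *m psi) 0 0 != 0) ->
  exists2 e : R, e != 0 & forall u, C u -> 0 < e * (u *m psi) 0 0.
Proof.
move=> CD CZ C0; have [[u Cu]|nC] := pselect (C !=set0); last first.
  by exists 1; rewrite ?oner_neq0 // => u Cu; case: nC; exists u.
exists ((u *m psi) 0 0); first exact: C0.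
move=> v Cv; rewrite lt_neqAle eq_sym mulf_neq0 ?C0 //= leNgt; apply/negP => uv.
have a0 := C0 _ Cu; have b0 := C0 _ Cv.
set a := (u *m psi) 0 0 in uv a0; set b := (v *m psi) 0 0 in uv b0.
have Cw : C (`|b| *: u + `|a| *: v).
  by apply: CD; apply: CZ; rewrite ?normr_gt0.
have := C0 _ Cw; rewrite evD !evZ -/a -/b.
have -> : `|b| * a + `|a| * b = 0.
  move: uv; have [aN|aP|] := ltgtP a 0; last by move/eqP; rewrite (negbTE a0).
    rewrite nmulr_rlt0 // => bP.
    by rewrite (ltr0_norm aN) (gtr0_norm bP); ring.
  by rewrite pmulr_rlt0 // => bN; rewrite (gtr0_norm aP) (ltr0_norm bN); ring.
by rewrite eqxx.
Qed.

Lemma patch_ev_neq0 (R : realType) (n : nat) (phi : 'cV[R]_n.+1) v (x : RP R n) :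
  affine_patch phi x -> lifts v x -> (v *m phi) 0 0 != 0.
Proof.
move=> px [c c0 ->]; rewrite evZ mulf_neq0 //; apply/eqP => E; apply: px.
by rewrite /hyperplane /= [LHS]mx11_scalar E -scalemx1 scale0r.
Qed.

Lemma sub_rows2 (F : fieldType) (m : nat) (u v w : 'rV[F]_m) :
  (w <= col_mx u v)%MS -> exists a b, w = a *: u + b *: v.
Proof.
rewrite -addsmxE => /sub_addsmxP[[D1 D2] ->]; exists (D1 0 0), (D2 0 0).
by rewrite [D1]mx11_scalar [D2]mx11_scalar !mul_scalar_mx !mxE !eqxx.
Qed.

Section ConeOver.
Variables (R : realType) (n : nat) (Om : set (RP R n)) (phi : 'cV[R]_n.+1).
Hypothesis oOm : open Om.
Hypothesis lineOm : forall L : 'M[R]_(2, n.+1), \rank L = 2%N ->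
  connected (proj_line L `&` Om).
Hypothesis patchOm : closure Om `<=` affine_patch phi.
Let C := cone_over Om phi.

Lemma lift_domain_ev_neq0 v x : Om x -> lifts v x -> (v *m phi) 0 0 != 0.
Proof. by move=> Ox; apply: patch_ev_neq0; apply: patchOm; exact: subset_closure. Qed.

Lemma cone_overZ t u : 0 < t -> C u -> C (t *: u).
Proof.
move=> t0 [[x Ox ux] u0]; split; last by rewrite evZ mulr_gt0.
by exists x => //; apply: lift_scale; rewrite ?gt_eqF.
Qed.

Lemma cone_over_independent u v : C u -> C v -> ~ C (u + v) ->
  row_free (col_mx u v).
Proof.
move=> Cu Cv nC; rewrite -kermx_eq0; apply/eqP.
apply/eqP/rowV0P => D; rewrite sub_kermx => /eqP DL.
rewrite -[D]hsubmxK mul_row_col [lsubmx D]mx11_scalar [rsubmx D]mx11_scalar in DL *.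
move: DL; set a := lsubmx D 0 0; set b := rsubmx D 0 0.
rewrite !mul_scalar_mx => E.
have [a0|a0] := eqVneq a 0.
  move: E; rewrite a0 scale0r add0r => /eqP; rewrite scaler_eq0 => /orP[/eqP ->|].
    by rewrite !raddf0 row_mx0.
  by case: Cv => -[x _ /lift_neq0/negbTE ->].
have uE : u = (- (b / a)) *: v.
  apply: (scalerI a0); rewrite scalerA mulrN mulrC divfK // scaleNr.
  by apply/eqP; rewrite -subr_eq0 opprK E.
exfalso; apply: nC; rewrite uE -{2}[v]scale1r -scalerDl.
apply: cone_overZ => //; apply: addr_gt0 => //.
have [_ v0] := Cv; have [_] := Cu.
by rewrite uE evZ pmulr_lgt0.
Qed.

(** This is where connectedness of line sections becomes convexity. If [u + v] is not in [C], its
    class is missing from [Om], and a form equal to 1 at [u] and -1 at [v] splits the section of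
    [Om] by the line through both into two relatively clopen pieces. *)
Lemma cone_overD u v : C u -> C v -> C (u + v).
Proof.
move=> Cu Cv; apply: contrapT => nC.
have rf := cone_over_independent Cu Cv nC.
have [X LX] := row_freeP rf.
have [[x Ox ux] u0] := Cu; have [[y Oy vy] v0] := Cv.
pose psi : 'cV[R]_n.+1 := X *m col_mx 1%:M (- 1%:M).
have Lpsi : col_mx u v *m psi = col_mx 1%:M (- 1%:M) by rewrite mulmxA LX mul1mx.
have [upsi vpsi] : u *m psi = 1%:M /\ v *m psi = - 1%:M.
  by move: Lpsi; rewrite mul_col_mx => /eq_col_mx.
have uL : (u <= col_mx u v)%MS by rewrite -addsmxE addsmxSl.
have vL : (v <= col_mx u v)%MS by rewrite -addsmxE addsmxSr.
pose L : 'M[R]_(2, n.+1) := col_mx u v.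
pose A := proj_line L `&` Om.
have Ax : A x.
  split => //; have [c c0 E] := ux.
  rewrite /proj_line /= (_ : rep x = c^-1 *: u); last by rewrite E scalerA mulVf ?scale1r.
  exact: scalemx_sub uL.
have Ay : A y.
  split => //; have [c c0 E] := vy.
  rewrite /proj_line /= (_ : rep y = c^-1 *: v); last by rewrite E scalerA mulVf ?scale1r.
  exact: scalemx_sub vL.
(* The product with [phi] is homogeneous of degree 2, so its sign does not depend on the lift. *)
pose Q z := (rep z *m psi) 0 0 * (rep z *m phi) 0 0.
have QN z : (rep z *m - psi) 0 0 * (rep z *m phi) 0 0 = - Q z.
  by rewrite mulmxN mxE mulNr.
have Qn0 z : A z -> Q z != 0.
  move=> [/sub_rows2[a [b zE]] Oz]; rewrite mulf_neq0 //; last first.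
    exact: lift_domain_ev_neq0 Oz (lift_rep z).
  apply/eqP => z0; apply: nC.
  have ab : a = b.
    move: z0; rewrite zE evD !evZ upsi vpsi !mxE eqxx /= mulrN !mulr1.
    by move/eqP; rewrite subr_eq0 => /eqP.
  have zE' : rep z = a *: (u + v) by rewrite zE -ab scalerDr.
  have a0 : a != 0.
    by apply: contraNneq (rep_neq0 z); rewrite zE' => ->; rewrite scale0r.
  split; last by rewrite evD addr_gt0.
  exists z => //; exists a^-1; rewrite ?invr_eq0 //.
  by rewrite zE' scalerA mulVf // scale1r.
have QE w z c : c != 0 -> w = c *: rep z ->
    (w *m psi) 0 0 * (w *m phi) 0 0 = c ^+ 2 * Q z.
  by move=> c0 ->; rewrite !evZ mulrACA -expr2.
have Qx : 0 < Q x.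
  have [c c0 E] := ux.
  have := QE _ _ _ c0 E; rewrite upsi mxE eqxx mul1r /= => E2.
  by move: u0; rewrite E2 pmulr_rgt0 // exprn_even_gt0.
have Qy : Q y < 0.
  have [c c0 E] := vy.
  have vp : (v *m psi) 0 0 = -1 by rewrite vpsi !mxE eqxx.
  have := QE _ _ _ c0 E; rewrite vp mulN1r => E2.
  by move: v0; rewrite -oppr_lt0 E2 pmulr_rlt0 // exprn_even_gt0.
have : A `&` [set z | 0 < Q z] = A.
  apply: (lineOm (L := L)).
  - by move: rf; rewrite /row_free => /eqP.
  - by exists x.
  - by exists [set z | 0 < Q z] => //; exact: open_ev_mul_gt0.
  - exists (~` [set z | 0 < - Q z]).
      apply: open_closedC; under eq_set do rewrite -QN.
      exact: open_ev_mul_gt0.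
    apply/seteqP; split=> z [Az] /= Qz; split=> //=.
      by rewrite oppr_gt0; apply/negP; rewrite -leNgt ltW.
    by move/negP: Qz; rewrite oppr_gt0 -leNgt lt_neqAle eq_sym Qn0.
move/seteqP => [_ /(_ _ Ay) [_ /=]].
by rewrite ltNge ltW.
Qed.

Lemma closure_liftP x v : closure Om x -> lifts v x -> 0 < (v *m phi) 0 0 ->
  closure C v.
Proof.
move=> clx vx v0 B /nbhs_interior Bv.
pose W := B^° `&` [set w | 0 < (w *m phi) 0 0].
have oW : open W.
  apply: openI; first exact: open_interior.
  apply: (@open_comp _ _ (fun v : 'rV[R]_n.+1 => (v *m phi) 0 0) [set t | 0 < t]).
    by move=> w _; apply: ev_continuous.
  exact: open_gt.
have [|y [Oy [w wy [Bw w0]]]] := clx [set y | exists2 w, lifts w y & W w].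
  apply: open_nbhs_nbhs; split; first exact: open_of_lift_chart.
  by exists v => //; split => //; apply: nbhs_singleton.
by exists w; split; [split => //; exists y|apply: interior_subset].
Qed.

Lemma closure_of_segment x v u : lifts v x ->
  (forall e, 0 < e -> C (v + e *: u)) -> closure Om x.
Proof.
move=> vx Cv B; rewrite nbhsE => -[U [oU Ux] UB].
have /open_nbhs_nbhs : open_nbhs v [set v | exists2 x, U x & lifts v x].
  by split; [exact: open_lift|exists x].
move=> /nbhs_ballP[e /= e0 He].
pose t := e / 2 / (`|u| + 1).
have u1 : 0 < `|u| + 1 by rewrite ltr_wpDl.
have t0 : 0 < t by rewrite !divr_gt0.
have [y Uy vy] : [set v | exists2 x, U x & lifts v x] (v + t *: u).
  apply: He; rewrite -ball_normE /= opprD addrA subrr add0r normrN normrZ.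
  rewrite gtr0_norm // -mulrA -ltr_pdivlMl ?divr_gt0 // (@le_lt_trans _ _ 1) //.
    by rewrite ler_pdivrMl // mulr1 lerDl.
  have -> : (e / 2)^-1 * e = 2 by field; rewrite gt_eqF.
  by rewrite ltr1n.
have [[z Oz vz] _] := Cv _ t0.
by exists y; split; [rewrite (lift_inj vy vz)|exact: UB].
Qed.

(** For [cone_ray]: a ray inside the cone converges projectively to its direction, a point of the
    hyperplane of [phi], which the closure of [Om] avoids. *)
Lemma cone_over_is_cone : is_cone phi C.
Proof.
split; [exact: cone_overD|exact: cone_overZ| |by move=> u []|].
  apply: openI; first exact: open_lift.
  apply: (@open_comp _ _ (fun v : 'rV[R]_n.+1 => (v *m phi) 0 0) [set t | 0 < t]).
    by move=> w _; apply: ev_continuous.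
  exact: open_gt.
move=> u w Cu w0 ew; apply: contrapT => nray.
have ray t : 0 < t -> C (u + t *: w).
  by move=> t0; apply: contrapT => nC; apply: nray; exists t.
have [x wx] := lift_exists w0.
suff clx : closure Om x.
  by have := patch_ev_neq0 (patchOm clx) wx; rewrite ew eqxx.
apply: (closure_of_segment (u := u) wx) => e e0.
rewrite (_ : _ + _ = e *: (u + e^-1 *: w)).
  by apply: cone_overZ => //; apply: ray; rewrite invr_gt0.
by rewrite scalerDr scalerA mulfV ?gt_eqF // scale1r addrC.
Qed.

Lemma cone_over_lift x : Om x -> exists2 v, C v & lifts v x.
Proof.
move=> Ox; have e0 := lift_domain_ev_neq0 Ox (lift_rep x).
exists ((rep x *m phi) 0 0 *: rep x); last exact: lift_scale e0 (lift_rep x).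
split; first by exists x => //; exact: lift_scale e0 (lift_rep x).
by rewrite evZ -expr2 exprn_even_gt0.
Qed.
End ConeOver.

(** * The cross-ratio formula in terms of the cone order *)

(** For [t > 0], [Y] is where the ray from [u] through [v] leaves [C]. Write [l *: v - u] as a
    combination of [u] and [Y]: a positive coefficient of [u] pushes it into the open cone, while a
    nonpositive one, moved to the other side, would put [Y] into [C]. *)
Lemma supporting_dominating (R : realType) (m : nat) (phi : 'cV[R]_m.+1)
    (C : set 'rV[R]_m.+1) (u v Y : 'rV[R]_m.+1) (t : R) :
  is_cone phi C -> C u -> C v -> (u *m phi) 0 0 = (v *m phi) 0 0 ->
  closure C Y -> ~ C Y -> 0 <= t -> t <= 1 -> v = (1 - t) *: u + t *: Y ->
  t < 1 /\ forall l, C (l *: v - u) <-> (1 - t)^-1 < l.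
Proof.
move=> hC Cu Cv uv cY nY t0 t1 vE.
have {}t1 : t < 1.
  rewrite lt_neqAle t1 andbT; apply/eqP => t1'; apply: nY.
  by move: Cv; rewrite vE t1' subrr scale0r add0r scale1r.
have t1' : 0 < 1 - t by rewrite subr_gt0.
split=> // l.
have lE : l *: v - u = (l * (1 - t) - 1) *: u + (l * t) *: Y.
  by rewrite vE; apply/rowP => i; rewrite !mxE; ring.
rewrite -div1r ltr_pdivrMr //; split=> [Cl|Hl].
  have l1 : 1 < l.
    move: (cone_pos hC Cl); rewrite evB evZ uv subr_gt0.
    by rewrite -{1}[(v *m phi) 0 0]mul1r ltr_pM2r // (cone_pos hC).
  rewrite ltNge; apply/negP => Hl; apply: nY.
  have tp : 0 < t.
    rewrite lt_neqAle t0 andbT; apply/eqP => t00.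
    by move: Hl; rewrite -t00 subr0 mulr1 leNgt l1.
  have lt0 : 0 < l * t by rewrite mulr_gt0 // (lt_trans _ l1).
  rewrite (_ : Y = (l * t)^-1 *: ((l *: v - u) + (1 - l * (1 - t)) *: u)).
    apply: (coneZ hC); first by rewrite invr_gt0.
    by apply: (cone_addZ hC) => //; rewrite subr_ge0.
  rewrite lE; apply/rowP => i; rewrite !mxE; field.
  by rewrite !gt_eqF // (lt_trans _ l1).
have l0 : 0 < l by rewrite -(pmulr_lgt0 _ t1') (lt_trans _ Hl).
have Cu' : C ((l * (1 - t) - 1) *: u) by apply: (coneZ hC); rewrite ?subr_gt0.
rewrite lE; move: t0 Cu'; rewrite le_eqVlt => /orP[/eqP <-|tp] Cu'.
  by rewrite mulr0 scale0r addr0.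
have lt0 : 0 < l * t by rewrite mulr_gt0.
rewrite (_ : _ + _ = (l * t) *: (Y + (l * t)^-1 *: ((l * (1 - t) - 1) *: u))).
  apply: (coneZ hC) => //; apply: (cone_closureD hC) => //.
  by apply: (coneZ hC); rewrite ?invr_gt0.
by rewrite scalerDr [(l * t) *: (_ *: _)]scalerA mulfV ?gt_eqF // scale1r addrC.
Qed.

Lemma ltr_mul_split (R : realType) (l0 k0 E : R) : 0 < l0 -> 0 < k0 -> 0 < E ->
  l0 * k0 < E <-> exists l k, [/\ l0 < l, k0 < k & l * k < E].
Proof.
move=> l00 k00 E0; split=> [H|[l [k [Hl Hk]]]]; last first.
  by apply: le_lt_trans; rewrite ler_pM // ltW.
(* Each factor takes a third of the logarithmic gap; the last third keeps the inequality strict. *)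
pose c := expR (ln (E / (l0 * k0)) / 3).
have q1 : 1 < E / (l0 * k0) by rewrite ltr_pdivlMr ?mul1r // mulr_gt0.
have lq : 0 < ln (E / (l0 * k0)) by rewrite ln_gt0.
have c1 : 1 < c by rewrite expR_gt1 divr_gt0.
exists (l0 * c), (k0 * c); rewrite !ltr_pMr //; split=> //.
rewrite mulrACA mulrC -ltr_pdivlMr ?mulr_gt0 // -expRD.
rewrite -[ltRHS]lnK ?posrE ?divr_gt0 ?mulr_gt0 // ltr_expR; lra.
Qed.

Section HilbertDist.
Variables (R : realType) (n : nat) (Om : set (RP R n)).
Hypothesis oOm : open Om.
Hypothesis lineOm : forall L : 'M[R]_(2, n.+1), \rank L = 2%N ->
  connected (proj_line L `&` Om).
Implicit Types (phi psi : 'cV[R]_n.+1) (a b x y : RP R n).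

Let in_patch phi := closure Om `<=` affine_patch phi.

Let cone phi (h : in_patch phi) : is_cone phi (cone_over Om phi).
Proof. exact: cone_over_is_cone. Qed.

Lemma chart_lift phi v x : lifts v x -> (v *m phi) 0 0 = 1 -> chart phi x = v.
Proof.
move=> [c c0 ->]; rewrite evZ => E; rewrite /chart; congr (_ *: _).
have r0 : (rep x *m phi) 0 0 != 0.
  by apply/eqP => r0; move: E; rewrite r0 mulr0 => /eqP; rewrite eq_sym oner_eq0.
by apply: (mulIf r0); rewrite mulVf // E.
Qed.

Lemma lift_chart phi x : in_patch phi -> closure Om x ->
  lifts (chart phi x) x /\ (chart phi x *m phi) 0 0 = 1.
Proof.
move=> h cx; have e0 := patch_ev_neq0 (h _ cx) (lift_rep x).
split; last by rewrite evZ mulVf.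
by apply: lift_scale (lift_rep x); rewrite invr_eq0.
Qed.

Lemma chart_cone_over phi x : in_patch phi -> Om x ->
  cone_over Om phi (chart phi x).
Proof.
move=> h Ox; have [lx ex] := lift_chart h (subset_closure Ox).
by split; [exists x|rewrite ex].
Qed.

Lemma boundary_notin y : boundary (closure Om) y -> ~ Om y.
Proof.
move=> [_ nint] Oy; apply: nint; have := oOm; rewrite openE => /(_ _ Oy).
by apply: interiorS; exact: subset_closure.
Qed.

Lemma boundary_chart phi y : in_patch phi -> boundary (closure Om) y ->
  closure (cone_over Om phi) (chart phi y) /\ ~ cone_over Om phi (chart phi y).
Proof.
move=> h hy; have [clcl _] := hy.
have cly : closure Om y.
  by rewrite -(closure_id (closure Om)).1 in clcl; last exact: closed_closure.
have [ly ey] := lift_chart h cly.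
split; first by apply: (closure_liftP cly ly); rewrite ey.
move=> [[x Ox lx] _]; apply: (boundary_notin hy).
by rewrite (lift_inj ly lx).
Qed.

(** [cone_ray] makes the exit parameter finite. The exit point must avoid the interior of the
    closure, not just [Om]: otherwise a point further out would lie in the closure of the cone, and
    a combination with [u] would put the exit point into the cone. *)
Lemma boundary_ray phi u w : in_patch phi -> cone_over Om phi u -> w != 0 ->
  (w *m phi) 0 0 = 0 ->
  exists s y, [/\ 0 < s, boundary (closure Om) y & lifts (u + s *: w) y].
Proof.
move=> h Cu w0 ew; have hC := cone h; set C := cone_over Om phi in Cu hC.
pose S := [set t : R | 0 <= t /\ C (u + t *: w)].
have S0 : S 0 by split; rewrite // scale0r addr0.
have [t0 t00 nC] := cone_ray hC Cu w0 ew.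
have Sub t : S t -> t <= t0.
  move=> [tp Ct]; rewrite leNgt; apply/negP => tt; apply: nC.
  by apply: (order_interval_scale hC t00 (ltW tt) Cu).
have supS : has_sup S by split; [exists 0|exists t0 => t; exact: Sub].
have open_at v : C v -> exists2 e : R, 0 < e & C (v + e *: w).
  move=> /(cone_ball hC)[e e0 He]; exists (e / 2 / `|w|).
    by rewrite !divr_gt0 // normr_gt0.
  apply: He; rewrite normrZ gtr0_norm ?divr_gt0 ?normr_gt0 //.
  by rewrite divfK ?normr_eq0 // ltr_pdivrMr // ltr_pMr // ltr1n.
set s := sup S.
have s0 : 0 < s.
  have [e e0 Ce] := open_at _ Cu.
  have Se : S e by split=> //; exact: ltW.
  exact: lt_le_trans e0 (sup_upper_bound supS Se).
have Clt t : 0 < t -> t < s -> C (u + t *: w).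
  move=> tp; rewrite -subr_gt0 => ts.
  have [t' [_ Ct'] tt'] := sup_adherent ts supS.
  apply: (order_interval_scale hC tp _ Cu Ct').
  by move: tt'; rewrite subKr => /ltW.
have nCs : ~ C (u + s *: w).
  move=> /open_at[e e0]; rewrite -addrA -scalerDl => Ce.
  have Se : S (s + e) by split; [rewrite addr_ge0 ?ltW|].
  by have := sup_upper_bound supS Se; rewrite gerDl leNgt e0.
have ez t : ((u + t *: w) *m phi) 0 0 = (u *m phi) 0 0.
  by rewrite evD evZ ew mulr0 addr0.
have u0 := cone_pos hC Cu.
have z0 : u + s *: w != 0.
  by apply/eqP => z0; move: u0; rewrite -(ez s) z0 mul0mx mxE ltxx.
have [y ly] := lift_exists z0.
have cly : closure Om y.
  apply: (closure_of_segment (phi := phi) (u := u) ly) => e e0.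
  have e1 : 0 < 1 + e by rewrite addr_gt0.
  rewrite (_ : _ + _ = (1 + e) *: (u + (s / (1 + e)) *: w)).
    apply: (coneZ hC) => //; apply: Clt; first by rewrite divr_gt0.
    by rewrite ltr_pdivrMr // ltr_pMr // ltrDl.
  by apply/rowP => i; rewrite !mxE; field; rewrite gt_eqF.
exists s, y; split=> //; split; first exact: subset_closure.
rewrite /interior nbhsE => -[U [oU Uy] UB].
have /open_nbhs_nbhs : open_nbhs (u + s *: w) [set v | exists2 x, U x & lifts v x].
  by split; [exact: open_lift|exists y].
move=> /nbhs_ballP[e /= e0 He].
pose d := e / 2 / `|w|.
have d0 : 0 < d by rewrite !divr_gt0 // normr_gt0.
have [y' Uy' ly'] : [set v | exists2 x, U x & lifts v x] (u + s *: w + d *: w).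
  apply: He; rewrite -ball_normE /= opprD addrA subrr add0r normrN normrZ.
  by rewrite gtr0_norm // divfK ?normr_eq0 // ltr_pdivrMr // ltr_pMr // ltr1n.
have clz : closure C (u + s *: w + d *: w).
  apply: (closure_liftP (UB _ Uy') ly').
  by rewrite -addrA -scalerDl ez.
apply: nCs.
rewrite (_ : _ + _ = (1 + d / s)^-1 *: ((u + s *: w + d *: w) + (d / s) *: u)).
  apply: (coneZ hC); first by rewrite invr_gt0 addr_gt0 // divr_gt0.
  by apply: (cone_closureD hC) => //; apply: (coneZ hC) => //; rewrite divr_gt0.
apply/rowP => i; rewrite !mxE; field.
by rewrite !gt_eqF // addr_gt0.
Qed.

Lemma cone_over_same_lift phi u v x : cone_over Om phi u -> cone_over Om phi v ->
  lifts u x -> lifts v x -> exists2 c, 0 < c & v = c *: u.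
Proof.
move=> [_ u0] [_ v0] [c c0 uE] [d d0 vE].
have E : v = (d / c) *: u by rewrite uE vE scalerA divfK.
by exists (d / c) => //; move: v0; rewrite E evZ pmulr_lgt0.
Qed.

Lemma cone_over_patch phi psi : in_patch phi -> in_patch psi ->
  exists e, forall v, cone_over Om phi v -> cone_over Om psi (e *: v).
Proof.
move=> h h'; have hC := cone h.
have [|e e0 He] := @cone_sign _ _ psi _ (coneD hC) (coneZ hC).
  by move=> v [[x Ox lx] _]; exact: (lift_domain_ev_neq0 h' Ox lx).
exists e => v Cv; have [[x Ox lx] _] := Cv.
by split; [exists x => //; exact: lift_scale|rewrite evZ; exact: He].
Qed.

(** The cones of two patches agree up to a sign, and two lifts of a point in one cone differ by a
    positive factor; neither affects the product [l * k]. *)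
Lemma hilbert_lt_patch phi psi u v u' v' a b r : in_patch phi -> in_patch psi ->
  cone_over Om phi u -> cone_over Om phi v ->
  cone_over Om psi u' -> cone_over Om psi v' ->
  lifts u a -> lifts v b -> lifts u' a -> lifts v' b ->
  hilbert_lt (cone_over Om phi) u v r -> hilbert_lt (cone_over Om psi) u' v' r.
Proof.
move=> h h' Cu Cv Cu' Cv' lu lv lu' lv' [l [k [h1 h2 h3]]].
have [e He] := cone_over_patch h h'.
have e0 : e != 0.
  apply/eqP => e0; have := cone_neq0 (cone h') (He _ Cu).
  by rewrite e0 scale0r eqxx.
have [c c0 ->] := cone_over_same_lift (He _ Cu) Cu' (lift_scale e0 lu) lu'.
have [d d0 ->] := cone_over_same_lift (He _ Cv) Cv' (lift_scale e0 lv) lv'.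
apply: (hilbert_lt_scale (cone h')) => //; exists l, k; split=> //.
  by rewrite scalerA mulrC -scalerA -scalerBr; exact: He.
by rewrite scalerA mulrC -scalerA -scalerBr; exact: He.
Qed.

Let is_hilbert_dist a b (r : R) := exists phi x y,
    [/\ phi != 0 /\ closure Om `<=` affine_patch phi,
        boundary (closure Om) x /\ boundary (closure Om) y,
        between (chart phi x) (chart phi a) (chart phi b),
        between (chart phi a) (chart phi b) (chart phi y)
      & r = ln ((`|chart phi b - chart phi x| * `|chart phi a - chart phi y|)
              / (`|chart phi b - chart phi y| * `|chart phi a - chart phi x|))].

(** The cross ratio splits into two length ratios, one for each end of the chord; by
    [supporting_dominating] these are the infima of the admissible l and k. *)
Lemma is_hilbert_dist_lt a b r0 : Om a -> Om b -> is_hilbert_dist a b r0 ->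
  exists phi, in_patch phi /\
    forall r, r0 < r <->
      hilbert_lt (cone_over Om phi) (chart phi a) (chart phi b) r.
Proof.
move=> Oa Ob [phi [x [y [[_ h] [bx by_] [t' [t'0 t'1 uE]] [t [t0 t1 vE]] r0E]]]].
exists phi; split=> // r.
have Cu := chart_cone_over h Oa; have Cv := chart_cone_over h Ob.
have eu := (lift_chart h (subset_closure Oa)).2.
have ev := (lift_chart h (subset_closure Ob)).2.
have [clx nx] := boundary_chart h bx; have [cly ny] := boundary_chart h by_.
have hC := cone h.
set u := chart phi a in uE vE r0E Cu eu *; set v := chart phi b in uE vE r0E Cv ev *.
set X := chart phi x in uE r0E clx nx; set Y := chart phi y in vE r0E cly ny.
have uv : (u *m phi) 0 0 = (v *m phi) 0 0 by rewrite eu ev.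
have [t1' Hl] := supporting_dominating hC Cu Cv uv cly ny t0 t1 vE.
(* The same chord read backwards, from [v] through [u] to [X], has parameter [1 - t']. *)
have [|||s1 Hk] := supporting_dominating (t := 1 - t') hC Cv Cu (esym uv) clx nx.
- by rewrite subr_ge0.
- by rewrite gerBl.
- by rewrite subKr addrC.
rewrite subKr in Hk; have t'p : 0 < t' by move: s1; rewrite gtrBl.
have tp : 0 < 1 - t by rewrite subr_gt0.
have uY : 0 < `|u - Y|.
  by rewrite normr_gt0 subr_eq0; apply/eqP => E; apply: ny; rewrite -E.
have vX : 0 < `|v - X|.
  by rewrite normr_gt0 subr_eq0; apply/eqP => E; apply: nx; rewrite -E.
have vYE : `|v - Y| = (1 - t) * `|u - Y|.
  rewrite (_ : v - Y = (1 - t) *: (u - Y)); first by rewrite normrZ gtr0_norm.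
  by rewrite vE; apply/rowP => i; rewrite !mxE; ring.
have uXE : `|u - X| = t' * `|v - X|.
  rewrite (_ : u - X = t' *: (v - X)); first by rewrite normrZ gtr0_norm.
  by rewrite uE; apply/rowP => i; rewrite !mxE; ring.
have {}r0E : r0 = ln ((1 - t)^-1 * t'^-1).
  rewrite r0E vYE uXE; congr ln; field.
  by rewrite !gt_eqF.
have -> : r0 < r <-> (1 - t)^-1 * t'^-1 < expR r.
  by rewrite r0E -ltr_expR lnK // posrE mulr_gt0 // invr_gt0.
rewrite ltr_mul_split ?invr_gt0 ?expR_gt0 //; split=> -[l [k [h1 h2 h3]]].
  by exists l, k; split=> //; [apply/Hl|apply/Hk].
by exists l, k; split=> //; [apply/Hl|apply/Hk].
Qed.

Lemma is_hilbert_dist_exists a b : (0 < n)%N ->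
  (exists2 phi, phi != 0 & in_patch phi) -> Om a -> Om b ->
  exists r, is_hilbert_dist a b r.
Proof.
move=> n0 [phi phi0 h] Oa Ob.
suff [x [y [bx by_ hx hy]]] : exists x y, [/\ boundary (closure Om) x,
    boundary (closure Om) y, between (chart phi x) (chart phi a) (chart phi b)
    & between (chart phi a) (chart phi b) (chart phi y)].
  by eexists; exists phi, x, y; split=> //.
have Cu := chart_cone_over h Oa; have Cv := chart_cone_over h Ob.
have eu := (lift_chart h (subset_closure Oa)).2.
have ev := (lift_chart h (subset_closure Ob)).2.
set u := chart phi a in Cu eu *; set v := chart phi b in Cv ev *.
clearbody u v.
have ray p w : cone_over Om phi p -> (p *m phi) 0 0 = 1 -> w != 0 ->
    (w *m phi) 0 0 = 0 ->
    exists s y, [/\ 0 < s, boundary (closure Om) y & chart phi y = p + s *: w].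
  move=> Cp ep w0 ew; have [s [y [s0 hy ly]]] := boundary_ray h Cp w0 ew.
  exists s, y; split=> //; apply: chart_lift => //.
  by rewrite evD evZ ew mulr0 addr0.
(* Equal points determine no chord: any direction in the kernel of [phi], nonzero since [0 < n],
   gives one boundary point that serves at both ends. *)
have [uv|uv] := eqVneq u v.
  have /rowV0Pn[w /sub_kermxP ew w0] : kermx phi != 0.
    rewrite -mxrank_eq0 mxrank_ker subn_eq0 -ltnNge.
    by rewrite (leq_ltn_trans (rank_leq_col _)).
  have {}ew : (w *m phi) 0 0 = 0 by rewrite ew mxE.
  have [s [y [s0 hy yE]]] := ray _ w Cu eu w0 ew.
  exists y, y; split=> //; rewrite -uv.
    by exists 1; rewrite subrr scale0r add0r scale1r ler01 lexx.
  by exists 0; rewrite subr0 scale0r addr0 scale1r ler01 lexx.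
have w0 : v - u != 0 by rewrite subr_eq0 eq_sym.
have wN0 : u - v != 0 by rewrite subr_eq0.
have [|s [y [s0 hy yE]]] := ray _ _ Cv ev w0; first by rewrite evB eu ev subrr.
have [|s' [x [s'0 hx xE]]] := ray _ _ Cu eu wN0; first by rewrite evB eu ev subrr.
exists x, y; split=> //.
  exists (s' / (1 + s')); have s1 : 0 < 1 + s' by rewrite addr_gt0.
  split; [by rewrite divr_ge0 ?ltW|by rewrite ler_pdivrMr // mul1r lerDr|].
  by rewrite xE; apply/rowP => i; rewrite !mxE; field; rewrite gt_eqF.
exists (1 + s)^-1; have s1 : 0 < 1 + s by rewrite addr_gt0.
split; [by rewrite invr_ge0 ltW|by rewrite invf_le1 // lerDl ltW|].
by rewrite yE; apply/rowP => i; rewrite !mxE; field; rewrite gt_eqF.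
Qed.

(** [get] may pick a value from another patch; it is compared there and carried back by
    [hilbert_lt_patch]. The later facts about distances are derived from this equivalence. *)
Lemma hilbert_dist_ltP phi u v a b r : (0 < n)%N -> phi != 0 ->
  in_patch phi -> cone_over Om phi u -> cone_over Om phi v ->
  lifts u a -> lifts v b ->
  hilbert_dist Om a b < r <-> hilbert_lt (cone_over Om phi) u v r.
Proof.
move=> n0 phi0 h Cu Cv lu lv.
have Oa : Om a by have [[x Ox lx] _] := Cu; rewrite (lift_inj lu lx).
have Ob : Om b by have [[x Ox lx] _] := Cv; rewrite (lift_inj lv lx).
have [r0 hr0] := is_hilbert_dist_exists n0 (ex_intro2 _ _ phi phi0 h) Oa Ob.
have hd : is_hilbert_dist a b (hilbert_dist Om a b) := getI hr0.
have [psi [h' ->]] := is_hilbert_dist_lt Oa Ob hd.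
have la := (lift_chart h' (subset_closure Oa)).1.
have lb := (lift_chart h' (subset_closure Ob)).1.
have Ca := chart_cone_over h' Oa; have Cb := chart_cone_over h' Ob.
split; first exact: (hilbert_lt_patch h' h Ca Cb Cu Cv la lb lu lv).
exact: (hilbert_lt_patch h h' Cu Cv Ca Cb lu lv la lb).
Qed.
End HilbertDist.

(** * Metric axioms and packing for the Hilbert distance *)

Section DomainMetric.
Variables (R : realType) (n : nat) (Om : set (RP R n)) (phi : 'cV[R]_n.+1).
Hypothesis n0 : (0 < n)%N.
Hypothesis oOm : open Om.
Hypothesis lineOm : forall L : 'M[R]_(2, n.+1), \rank L = 2%N ->
  connected (proj_line L `&` Om).
Hypothesis phi0 : phi != 0.
Hypothesis patchOm : closure Om `<=` affine_patch phi.
Implicit Types (a b c : RP R n).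
Local Notation d := (hilbert_dist Om).
Local Notation C := (cone_over Om phi).

Let hC : is_cone phi C.
Proof. exact: cone_over_is_cone. Qed.

Let ltP u v a b r : C u -> C v -> lifts u a -> lifts v b ->
  d a b < r <-> hilbert_lt C u v r.
Proof. exact: hilbert_dist_ltP. Qed.

Lemma hilbert_dist_ge0 a b : Om a -> Om b -> 0 <= d a b.
Proof.
move=> /(cone_over_lift patchOm)[u Cu lu] /(cone_over_lift patchOm)[v Cv lv].
rewrite leNgt; apply/negP => /(ltP _ Cu Cv lu lv).
by move=> /(hilbert_lt_gt0 hC Cu Cv); rewrite ltxx.
Qed.

Lemma hilbert_distxx a : Om a -> d a a = 0.
Proof.
move=> Oa; apply/eqP; rewrite eq_le hilbert_dist_ge0 // andbT.
have [u Cu lu] := cone_over_lift patchOm Oa.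
apply/ler_addgt0Pr => e e0; rewrite add0r ltW //.
by apply/(ltP _ Cu Cu lu lu); exact: (hilbert_lt_refl hC).
Qed.

Lemma hilbert_distC a b : Om a -> Om b -> d a b = d b a.
Proof.
move=> /(cone_over_lift patchOm)[u Cu lu] /(cone_over_lift patchOm)[v Cv lv].
apply/eqP; rewrite eq_le; apply/andP; split; rewrite leNgt; apply/negP.
  by move=> /(ltP _ Cv Cu lv lu)/hilbert_lt_sym/(ltP _ Cu Cv lu lv); rewrite ltxx.
by move=> /(ltP _ Cu Cv lu lv)/hilbert_lt_sym/(ltP _ Cv Cu lv lu); rewrite ltxx.
Qed.

Lemma hilbert_dist_triangle b a c : Om a -> Om b -> Om c ->
  d a c <= d a b + d b c.
Proof.
move=> /(cone_over_lift patchOm)[u Cu lu] /(cone_over_lift patchOm)[v Cv lv].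
move=> /(cone_over_lift patchOm)[w Cw lw]; apply/ler_addgt0Pr => e e0.
apply/ltW/(ltP _ Cu Cw lu lw).
rewrite [e]splitr addrACA; apply: (hilbert_lt_trans hC Cu Cv Cw).
  by apply/(ltP _ Cu Cv lu lv); rewrite ltrDl divr_gt0.
by apply/(ltP _ Cv Cw lv lw); rewrite ltrDl divr_gt0.
Qed.

Lemma cone_over_lift1 a : Om a ->
  exists v, [/\ C v, lifts v a & (v *m phi) 0 0 = 1].
Proof.
move=> Oa; exists (chart phi a).
have [la ea] := lift_chart patchOm (subset_closure Oa).
by split=> //; exact: chart_cone_over.
Qed.

Lemma hilbert_dist_eq0 a b : Om a -> Om b -> d a b <= 0 -> a = b.
Proof.
move=> /cone_over_lift1[u [Cu lu eu]] /cone_over_lift1[v [Cv lv ev]] d0.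
suff uv : u = v by apply: lift_inj lu _; rewrite uv.
apply: (hilbert_lt_eq hC) => //; first by rewrite eu ev.
by move=> r r0; apply/(ltP _ Cu Cv lu lv); apply: le_lt_trans r0.
Qed.

Lemma hilbert_ball_packing (N M : nat) (E e : R) (q : RP R n)
    (x : 'I_N -> RP R n) :
  (0 < M)%N -> (M.+1 ^ n.+1 < N)%N -> 0 < e -> Om q -> (forall i, Om (x i)) ->
  (forall i, d q (x i) < E) ->
  2 * n.+1%:R * expR E ^+ 2 / M%:R <= expR (e / 4) - 1 ->
  exists i j : 'I_N, (i < j)%N /\ d (x i) (x j) < e.
Proof.
move=> M0 MN e0 Oq Ox dE hM.
have [q0 [Cq lq eq]] := cone_over_lift1 Oq.
have /choice[v Hv] : forall i, exists v, [/\ C v, lifts v (x i) & (v *m phi) 0 0 = 1].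
  by move=> i; exact: cone_over_lift1.
have Cv i : C (v i) by have [] := Hv i.
have lv i : lifts (v i) (x i) by have [] := Hv i.
have ev i : (v i *m phi) 0 0 = 1 by have [] := Hv i.
have dlt i : hilbert_lt C q0 (v i) E by apply/(ltP _ Cq (Cv i) lq (lv i)).
have [||i [j [ij h1 h2]]] :=
    cone_packing hC M0 MN (expR_gt0 E) Cq Cv _ _ hM.
- by move=> i; apply: (hilbert_lt_dominating hC) => //; rewrite eq ev.
- move=> i; apply: (hilbert_lt_dominating hC) => //; first by rewrite eq ev.
  exact: hilbert_lt_sym.
exists i, j; split=> //; apply/(ltP _ (Cv i) (Cv j) (lv i) (lv j)).
(* The factor [expR (e / 4)] in both directions has product [expR (e / 2)], strictly below
   [expR e]. *)
move: h1 h2; rewrite subrKC => h1 h2.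
by apply: (hilbert_lt_of_dominating h1 h2); rewrite expr2 -expRD ltr_expR; lra.
Qed.
End DomainMetric.

Lemma coord_le_norm (R : realType) (m : nat) (w : 'rV[R]_m) j : `|w 0 j| <= `|w|.
Proof.
rewrite [leRHS]/Num.norm /= mx_normrE; apply/bigmax_geP; right => /=.
by exists (0, j).
Qed.

Lemma norm_le_coord (R : realType) (m : nat) (w : 'rV[R]_m) (e : R) : 0 <= e ->
  (forall j, `|w 0 j| <= e) -> `|w| <= e.
Proof.
move=> e0 H; rewrite [leLHS]/Num.norm /= mx_normrE; apply/bigmax_leP; split=> //.
by move=> [i j] _ /=; rewrite ord1.
Qed.

(** * Discrete groups *)

Section Manifold.
Variables (R : realType) (n : nat) (Om : set (RP R n)).
Variables (Ga : set (RP R n -> RP R n)) (phi : 'cV[R]_n.+1).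
Hypothesis n0 : (0 < n)%N.
Hypothesis hM : properly_convex_manifold Om Ga.
Hypothesis phi0 : phi != 0.
Hypothesis patchOm : closure Om `<=` affine_patch phi.
Implicit Types (a b c p : RP R n) (g : RP R n -> RP R n).
Local Notation d := (hilbert_dist Om).
Local Notation C := (cone_over Om phi).

Let oOm : open Om := pcm_open hM.
Let lineOm := (pcm_convex hM).1.
Let hC : is_cone phi C.
Proof. exact: cone_over_is_cone. Qed.

Let dist_ge0 := @hilbert_dist_ge0 R n Om phi n0 oOm lineOm phi0 patchOm.
Let distxx := @hilbert_distxx R n Om phi n0 oOm lineOm phi0 patchOm.
Let dist_sym := @hilbert_distC R n Om phi n0 oOm lineOm phi0 patchOm.
Let dist_triangle := @hilbert_dist_triangle R n Om phi n0 oOm lineOm phi0 patchOm.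
Let dist_eq0 := @hilbert_dist_eq0 R n Om phi n0 oOm lineOm phi0 patchOm.
Let dist_ltP u v a b r (Cu : C u) (Cv : C v) (lu : lifts u a) (lv : lifts v b) :=
  hilbert_dist_ltP oOm lineOm r n0 phi0 patchOm Cu Cv lu lv.

Lemma group_preserves g a : Ga g -> Om a -> Om (g a).
Proof. by move=> /(pcm_preserves hM) gOm Oa; rewrite -gOm; exists a. Qed.

Lemma group_iter g i : Ga g -> Ga (iter i g).
Proof.
move=> Gg; elim: i => [|i IH]; first exact: pg_id (pcm_group hM).
exact: pg_comp (pcm_group hM) _ _ Gg IH.
Qed.

(** A matrix of [g] could exchange the cone with its opposite; [cone_sign] corrects the sign. The
    converse implication uses that [g] maps [Om] onto itself. *)
Lemma group_matrix g : Ga g -> exists A : 'M[R]_n.+1,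
  [/\ A \in unitmx, induces A g & forall v, C v <-> C (v *m A)].
Proof.
move=> Gg; have [A Au Ag] := pg_transformation (pcm_group hM) Gg.
have [|e e0 He] := @cone_sign _ _ (A *m phi) _ (coneD hC) (coneZ hC).
  move=> u [[x Ox lx] _]; rewrite mulmxA.
  have gx := induces_lift Au Ag lx; have Ogx := group_preserves Gg Ox.
  exact: (lift_domain_ev_neq0 patchOm Ogx gx).
have eAu : e *: A \in unitmx by rewrite unitmxZ // unitfE.
have eAg : induces (e *: A) g.
  apply: induces_of_lift => v x lx; rewrite -scalemxAr; apply: lift_scale => //.
  exact: induces_lift.
have CA v : C v -> C (v *m (e *: A)).
  move=> Cv; have [[x Ox lx] _] := Cv; split.
    by exists (g x); [exact: group_preserves|exact: induces_lift].
  by rewrite -scalemxAr evZ -mulmxA; exact: He.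
exists (e *: A); split=> // v; split=> [|CvA]; first exact: CA.
have [[y Oy ly] _] := CvA.
have [x Ox gx] : (g @` Om) y by rewrite (pcm_preserves hM Gg).
have [u Cu lu] := cone_over_lift patchOm Ox.
have ly' : lifts (u *m (e *: A)) y by rewrite -gx; exact: induces_lift.
have [c c0 E] := cone_over_same_lift (CA _ Cu) CvA ly' ly.
have -> : v = c *: u.
  by rewrite -[LHS](mulmxK eAu) E -[RHS](mulmxK eAu) scalemxAl.
exact: (coneZ hC c0 Cu).
Qed.

Lemma hilbert_dist_isometry g a b : Ga g -> Om a -> Om b -> d (g a) (g b) = d a b.
Proof.
have le h x y : Ga h -> Om x -> Om y -> d (h x) (h y) <= d x y.
  move=> Gh Ox Oy; have [A [Au Ah CA]] := group_matrix Gh.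
  have [u Cu lu] := cone_over_lift patchOm Ox.
  have [v Cv lv] := cone_over_lift patchOm Oy.
  have lu' := induces_lift Au Ah lu; have lv' := induces_lift Au Ah lv.
  apply/ler_addgt0Pr => e e0; apply/ltW.
  have Cu' := (CA u).1 Cu; have Cv' := (CA v).1 Cv.
  apply/(dist_ltP _ Cu' Cv' lu' lv').
  apply: hilbert_lt_map => [w /CA //|].
  by apply/(dist_ltP _ Cu Cv lu lv); rewrite ltrDl.
move=> Gg Oa Ob; apply/eqP; rewrite eq_le le //=.
have [h [Gh gK hK]] := pg_inv (pcm_group hM) Gg.
by rewrite -{1}(gK a) -{1}(gK b) le //; exact: group_preserves.
Qed.

Lemma torsion_free_iter g i j : Ga g -> (i < j)%N -> iter i g = iter j g -> g = id.
Proof.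
move=> Gg ij E; apply/funext.
have [h [Gh gK hK]] := pg_inv (pcm_group hM) (group_iter i Gg).
apply: (@pcm_torsion_free _ _ _ _ hM g (j - i)%N); rewrite ?subn_gt0 // => x.
by rewrite -{1}(hK x) -iterD subnK ?(ltnW ij) // -E hK.
Qed.

Lemma discrete_near_id : exists2 e : R, 0 < e & forall (B : 'M[R]_n.+1) g,
  Ga g -> B \in unitmx -> induces B g ->
  (forall i j, `|(B - 1%:M) i j| < e) -> g = id.
Proof.
have Gid := pg_id (pcm_group hM).
have [W oW WG] := pcm_discrete hM Gid.
have [Wid _] : (W `&` Ga) id by rewrite WG.
have S1 : [set A : 'M[R]_n.+1 | A \in unitmx /\ exists2 g, W g & induces A g] 1%:M.
  split; first exact: unitmx1.
  by exists id => //; apply: induces_of_lift => v x; rewrite mulmx1.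
have /nbhs_ballP[e /= e0 He] := open_nbhs_nbhs (conj oW S1).
exists e => // B g Gg Bu Bg HB.
have [|_ [g' Wg' Bg']] := He B.
  split=> // i j; have := HB i j; rewrite !mxE distrC.
  by rewrite -ball_normE.
have E : g = g'.
  apply/funext => x; apply: lift_inj (induces_lift Bu Bg (lift_rep x)) _.
  exact: (induces_lift Bu Bg' (lift_rep x)).
by have : (W `&` Ga) g by [split=> //; rewrite E]; rewrite WG.
Qed.

(** A matrix of [g] is determined only up to scale. Making it preserve the value of [phi] at [v]
    turns the distance bound into two order inequalities with a fixed constant. *)
Lemma normalized_matrix g p v : Ga g -> C v -> lifts v p -> d p (g p) < 1 ->
  exists A : 'M[R]_n.+1, [/\ A \in unitmx, induces A g,
    forall w, C w <-> C (w *m A), C (expR 1 *: (v *m A) - v)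
    & C (expR 1 *: v - v *m A)].
Proof.
move=> Gg Cv lv dp; have [A [Au Ag CA]] := group_matrix Gg.
have CvA := (CA v).1 Cv.
pose s := (v *m phi) 0 0 / (v *m A *m phi) 0 0.
have s0 : 0 < s by rewrite divr_gt0 // (cone_pos hC).
have sE w : w *m (s *: A) = s *: (w *m A) by rewrite scalemxAr.
have sAu : s *: A \in unitmx by rewrite unitmxZ // unitfE gt_eqF.
have sAg : induces (s *: A) g.
  apply: induces_of_lift => w x lw; rewrite sE; apply: lift_scale.
    by rewrite gt_eqF.
  exact: induces_lift.
have sCA w : C w <-> C (w *m (s *: A)).
  rewrite sE; split=> [/CA|]; first exact: (coneZ hC).
  have si : 0 < s^-1 by rewrite invr_gt0.
  move=> /(coneZ hC si); rewrite scalerA mulVf ?gt_eqF // scale1r.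
  exact: (CA w).2.
have CvsA := (sCA v).1 Cv.
have ee : (v *m phi) 0 0 = (v *m (s *: A) *m phi) 0 0.
  by rewrite sE evZ divfK // gt_eqF // (cone_pos hC).
have hl : hilbert_lt C v (v *m (s *: A)) 1.
  have lgv := induces_lift sAu sAg lv.
  by apply/(dist_ltP _ Cv CvsA lv lgv).
exists (s *: A); split=> //; apply: (hilbert_lt_dominating hC) => //.
exact: hilbert_lt_sym.
Qed.

Lemma induces_inv (A : 'M[R]_n.+1) g h : A \in unitmx -> induces A g ->
  cancel g h -> induces (invmx A) h.
Proof.
move=> Au Ag gK; apply: induces_of_lift => v x lv.
have iv0 : v *m invmx A != 0.
  apply: contraNneq (lift_neq0 lv) => E.
  by rewrite -(mulmxKV Au v) E mul0mx.
have [y ly] := lift_exists iv0.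
have := induces_lift Au Ag ly; rewrite mulmxKV // => gy.
by rewrite -(lift_inj gy lv) gK.
Qed.

Lemma induces_comp (A B : 'M[R]_n.+1) g h : A \in unitmx -> B \in unitmx ->
  induces A g -> induces B h -> induces (A *m B) (h \o g).
Proof.
move=> Au Bu Ag Bh; apply: induces_of_lift => v x lv; rewrite mulmxA.
exact: (induces_lift Bu Bh (induces_lift Au Ag lv)).
Qed.

(* Proper discontinuity: normalised matrices of the elements moving p by less
   than 1 are bounded, so among many of them two are close, and their quotient
   is the identity by discreteness. *)
Lemma small_displacement_pigeonhole p : Om p ->
  exists N, forall h : 'I_N -> RP R n -> RP R n, (forall i, Ga (h i)) ->
    (forall i, d p (h i p) < 1) -> exists i j : 'I_N, (i < j)%N /\ h i = h j.
Proof.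
move=> Op; have [v Cv lv] := cone_over_lift patchOm Op.
have [e e0 He] := discrete_near_id.
have [B B0 HB] := order_interval_bounded hC Cv.
have [t t0 Ht] := cone_ball hC Cv.
pose E : R := expR 1; have E0 : 0 < E by exact: expR_gt0.
(* [v] plus or minus [t / 2] times a basis vector lies in [C], which bounds the rows of normalised
   matrices by [K]; [eta] makes the final bound [eta * E * B] equal to [e / 2]. *)
pose K := B * E * 2 / t; have K0 : 0 < K by rewrite !(divr_gt0, mulr_gt0).
pose eta := e / (2 * E * B); have eta0 : 0 < eta by rewrite divr_gt0 ?mulr_gt0.
have small w s : 0 < s -> `|w| < s * t -> C (s *: v + w).
  move=> s0 ws; rewrite (_ : _ + w = s *: (v + s^-1 *: w)).
    apply: (coneZ hC) => //; apply: Ht.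
    by rewrite normrZ gtr0_norm ?invr_gt0 // ltr_pdivrMl.
  by rewrite scalerDr scalerA mulfV ?gt_eqF // scale1r.
have bounded w s : 0 < s -> C (s *: v + w) -> C (s *: v - w) -> `|w| <= s * B.
  move=> s0 C1 C2; have si : 0 < s^-1 by rewrite invr_gt0.
  have vE : v = s^-1 *: (s *: v) by rewrite scalerA mulVf ?gt_eqF // scale1r.
  have := HB (s^-1 *: w); rewrite {1 2}vE -scalerDr -scalerBr.
  move=> /(_ (coneZ hC si C1) (coneZ hC si C2)).
  by rewrite normrZ gtr0_norm // ler_pdivrMl.
pose M := (Num.truncn (2 * K / (eta * t))).+1.
have et0 : 0 < eta * t by exact: mulr_gt0.
have MK : 2 * K / M%:R < eta * t.
  have Mr : 0 < M%:R :> R by rewrite ltr0n.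
  by rewrite ltr_pdivrMr // -ltr_pdivrMl // mulrC; exact: truncnS_gt.
exists (M.+1 ^ #|{: 'I_n.+1 * 'I_n.+1}|).+1 => h Gh dh.
have /choice[A HA] : forall i, exists A : 'M[R]_n.+1, [/\ A \in unitmx,
    induces A (h i), forall w, C w <-> C (w *m A), C (E *: (v *m A) - v)
    & C (E *: v - v *m A)].
  by move=> i; exact: normalized_matrix (Gh i) Cv lv (dh i).
pose ek k : 'rV[R]_n.+1 := delta_mx 0 k.
have coord k (X : 'M[R]_n.+1) l : (ek k *m X) 0 l = X k l.
  by rewrite /ek -rowE mxE.
have AK i k l : `|A i k l| <= K.
  have [Au Ah CA C1 C2] := HA i.
  rewrite -coord; apply: le_trans (coord_le_norm _ _) _.
  have sgn (x : R) : `|x| = t / 2 ->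
      C (E *: v + x *: (ek k *m A i)).
    move=> xt; rewrite (_ : _ + _ = (E *: v - v *m A i)
        + (v + x *: ek k) *m A i).
      apply: (coneD hC) => //; apply: (CA _).1; apply: Ht.
      rewrite normrZ xt.
      have : `|ek k| <= 1.
        apply: norm_le_coord => // j; rewrite /ek mxE eqxx /=.
        by case: eqP => _; rewrite ?normr1 ?normr0.
      have t2 : 0 < t / 2 by rewrite divr_gt0.
      by move=> /(ler_wpM2l (ltW t2)) /le_lt_trans; apply; lra.
    by rewrite mulmxDl -scalemxAl addrA subrK.
  have t2 : 0 < t / 2 by rewrite divr_gt0.
  have := bounded ((t / 2) *: (ek k *m A i)) E E0.
  have nt2 : `|t / 2| = t / 2 by exact: gtr0_norm.
  have nt2' : `|- (t / 2)| = t / 2 by rewrite normrN.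
  rewrite -scaleNr => /(_ (sgn _ nt2) (sgn _ nt2')).
  rewrite normrZ nt2.
  by rewrite -ler_pdivlMl // => /le_trans; apply; rewrite /K invf_div; lra.
pose c i (kl : 'I_n.+1 * 'I_n.+1) := A i kl.1 kl.2 / K.
have [||i [j [ij cij]]] := @grid_pigeonhole R _ _ M c _ (ltnSn _).
- by [].
- by move=> i [k l]; rewrite /c normrM normfV [`|K|]gtr0_norm // ler_pdivrMr // mul1r.
exists i, j; split=> //.
have [Au Ah CA C1 C2] := HA i; have [Bu Bh CB D1 D2] := HA j.
have [hj [Ghj hjK Khj]] := pg_inv (pcm_group hM) (Gh j).
suff id_h : hj \o h i = id.
  apply/funext => x; rewrite -[LHS]Khj.
  by have := congr1 (fun f => f x) id_h => /= ->.
have Bi := induces_inv Bu Bh hjK.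
apply: (He (A i *m invmx (A j))).
- exact: pg_comp (pcm_group hM) _ _ Ghj (Gh i).
- by rewrite unitmx_mul Au unitmx_inv.
- by apply: induces_comp => //; rewrite unitmx_inv.
move=> k l; rewrite -coord; apply: le_lt_trans (coord_le_norm _ _) _.
pose w := ek k *m (A i - A j).
have -> : ek k *m (A i *m invmx (A j) - 1%:M) = w *m invmx (A j).
  by rewrite -mulmxA mulmxBl mulmxV.
have wt : `|w| < eta * t.
  apply: le_lt_trans MK; apply: norm_le_coord => [|m].
    by rewrite divr_ge0 // mulr_ge0 ?ltW.
  have := cij (k, m); rewrite /c /= -mulrBl normrM normfV [`|K|]gtr0_norm //.
  rewrite ler_pdivrMr // => /le_trans; rewrite coord !mxE; apply; lra.
(* [w] is small against [eta *: v], which is below [(eta * E) *: (v *m A j)]. The inverse of [A j]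
   preserves [C], so pulling back gives an order interval at a multiple of [v], and no norm of the
   inverse enters. *)
have wC x : `|x| = 1 -> C ((eta * E) *: v + x *: (w *m invmx (A j))).
  move=> x1; apply: (CB _).2.
  rewrite (_ : _ *m _ = eta *: (E *: (v *m A j) - v) + (eta *: v + x *: w)).
    apply: (coneD hC); first exact: (coneZ hC).
    by apply: small => //; rewrite normrZ x1 mul1r.
  rewrite mulmxDl -!scalemxAl mulmxKV // scalerBr scalerA addrA.
  by rewrite subrK.
apply: (@le_lt_trans _ _ (eta * E * B)).
  apply: bounded; first by rewrite mulr_gt0.
    by have := wC 1; rewrite scale1r normr1; apply.
  by have := wC (-1); rewrite scaleN1r normrN1; apply.
have -> : eta * E * B = e / 2 by rewrite /eta; field; rewrite !gt_eqF.
lra.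
Qed.

(** * Free action, displacements and embedded balls *)

Lemma group_free g p : Ga g -> Om p -> g p = p -> g = id.
Proof.
move=> Gg Op gp; have [N HN] := small_displacement_pigeonhole Op.
have [||i [j [ij E]]] := HN (fun i => iter i g).
- by move=> i; exact: group_iter.
- move=> i; suff -> : iter i g p = p by rewrite (distxx).
  by elim: (i : nat) => //= k ->.
exact: torsion_free_iter Gg ij E.
Qed.

(** Otherwise nontrivial elements could be chosen one after the other, each with displacement below
    the previous one and positive by freeness; these are pairwise distinct, against the
    pigeonhole. *)
Lemma displacement_lower_bound p : Om p -> exists2 r : R, 0 < r &
  forall g, Ga g -> d p (g p) < r -> g = id.
Proof.
move=> Op; apply: contrapT => nr.
have /choice[F HF] : forall r : R, exists g,
    0 < r -> [/\ Ga g, d p (g p) < r & g <> id].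
  move=> r; have [r0|] := ltP 0 r; last by exists id.
  apply: contrapT => H; apply: nr; exists r => // g Gg dg.
  by apply: contrapT => gn; apply: H; exists g.
pose e := fix e k : R := if k is k'.+1 then d p (F (e k') p) else 1.
have pos (r : R) : 0 < r -> 0 < d p (F r p).
  move=> r0; have [Gg _ gn] := HF _ r0; have Og := group_preserves Gg Op.
  rewrite ltNge; apply/negP => /(dist_eq0 Op Og) E.
  by apply: gn; apply: (group_free Gg Op); rewrite -E.
have e0 k : 0 < e k by elim: k => [|k IH]; [exact: ltr01|exact: pos].
have edec k : e k.+1 < e k by have [] := HF _ (e0 k).
have elt : {homo e : i j / (i < j)%N >-> j < i}.
  by apply: homo_ltn => // y x z xy yz; exact: lt_trans yz xy.
have [N HN] := small_displacement_pigeonhole Op.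
have [||i [j [ij E]]] := HN (fun i => F (e i)).
- by move=> i; have [] := HF _ (e0 i).
- move=> i; apply: (@lt_le_trans _ _ (e i)); first exact: edec.
  by case: (i : nat) => // k; apply/ltW/(elt 0%N).
by have := elt i.+1 j.+1 ij; rewrite /= E ltxx.
Qed.

Lemma orbit_group g a : Ga g -> Defs.orbit Ga (g a) = Defs.orbit Ga a.
Proof.
have sub h x : Ga h -> Defs.orbit Ga (h x) `<=` Defs.orbit Ga x.
  move=> Gh _ [k Gk <-]; exists (k \o h) => //.
  exact: pg_comp (pcm_group hM) _ _ Gk Gh.
move=> Gg; apply/seteqP; split; first exact: sub.
have [h [Gh gK _]] := pg_inv (pcm_group hM) Gg.
by rewrite -{1}(gK a); exact: sub.
Qed.

Lemma orbit_refl a : Defs.orbit Ga a a.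
Proof. by exists id => //; exact: pg_id (pcm_group hM). Qed.

Lemma embedded_ball_displacement P r g x : embedded_ball Om Ga P r -> P x ->
  Om x -> Ga g -> d x (g x) < r -> g = id.
Proof.
move=> eP Px Ox Gg dr; apply: (group_free Gg Ox).
have Ogx := group_preserves Gg Ox.
have dxx := distxx Ox.
have := dist_ge0 Ox Ogx => d0.
apply: (eP x Px); rewrite ?inE /hilbert_ball /=; last exact: orbit_group.
  by [].
by split=> //; rewrite dxx (le_lt_trans d0).
Qed.

(** Two points [a] and [g a] of the ball around [x] give a path from [x] over [g a] to [g x], both
    parts shorter than [r]; hence the factor 2. *)
Lemma embedded_ball_of_displacement P r : P `<=` Om ->
  (forall g x, P x -> Ga g -> d x (g x) < 2 * r -> g = id) -> embedded_ball Om Ga P r.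
Proof.
move=> PO H x Px a b; rewrite !inE /hilbert_ball /= => -[Oa da] [Ob db] ab.
have Ox := PO _ Px.
have [g Gg gab] : Defs.orbit Ga a b by rewrite ab; exact: orbit_refl.
rewrite -gab (H g x) //; apply: le_lt_trans
  (dist_triangle Ox Ob (group_preserves Gg Ox)) _.
rewrite -{2}gab hilbert_dist_isometry // [d a x]dist_sym //.
by rewrite mulr_natl mulr2n ltrD.
Qed.

Lemma inj_radius_gt0 P : quotient_points Om Ga P -> (0 < inj_radius Om Ga P)%E.
Proof.
move=> [p Op <-]; have [r r0 Hr] := displacement_lower_bound Op.
have r20 : 0 < r / 2 by rewrite divr_gt0.
apply: (@lt_le_trans _ _ (r / 2)%:E); first by rewrite lte_fin.
apply: ereal_sup_ubound; exists (r / 2) => //; split=> //.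
apply: embedded_ball_of_displacement => [_ [k Gk <-]|g _ [k Gk <-] Gg].
  exact: group_preserves.
rewrite mulrC divfK // => dg.
have [h [Gh kK Kk]] := pg_inv (pcm_group hM) Gk.
have Ggk := pg_comp (pcm_group hM) Gg Gk.
(* The displacement of [g] at the lift [k p] is that of its conjugate by [k] at [p]. *)
have id_c : h \o (g \o k) = id.
  apply: Hr; first exact: pg_comp (pcm_group hM) _ _ Gh Ggk.
  rewrite /= -{1}(kK p) hilbert_dist_isometry //; first exact: group_preserves.
  exact: (group_preserves Ggk Op).
apply/funext => x; rewrite -(Kk x) /=.
by rewrite -[LHS]Kk; congr k; exact: (congr1 (fun f => f (h x)) id_c).
Qed.

Lemma hilbert_dist_iter g x i : Ga g -> Om x -> d x (iter i g x) <= i%:R * d x (g x).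
Proof.
move=> Gg Ox; elim: i => [|i IH].
  by rewrite mul0r /= (distxx Ox).
have Ogx := group_preserves Gg Ox.
have Oi := group_preserves (group_iter i Gg) Ox.
apply: le_trans (dist_triangle Ox Ogx _) _.
  exact: group_preserves (group_iter i.+1 Gg) Ox.
by rewrite /= hilbert_dist_isometry // -natr1 mulrDl mul1r addrC lerD2r.
Qed.

(* Many iterates of a small displacement of x keep a inside a fixed ball around
   x; by packing two of them are close, so a power of g moves a by less than r. *)
Lemma small_displacement_trivial P (r D rho : R) (M : nat) a x g :
  embedded_ball Om Ga P r -> 0 < r -> P a -> Om a -> Om x -> Ga g ->
  d a x < D + 1 -> (0 < M)%N ->
  2 * n.+1%:R * expR (D + 2) ^+ 2 / M%:R <= expR (r / 4) - 1 ->
  2 * rho * (M.+1 ^ n.+1)%:R <= 1 -> d x (g x) < 2 * rho -> g = id.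
Proof.
move=> eP r0 Pa Oa Ox Gg dax M0 hDM hrho dgx.
have rho0 : 0 <= 2 * rho.
  apply: le_trans (ltW dgx); apply: (dist_ge0 Ox).
  exact: group_preserves.
pose N := (M.+1 ^ n.+1)%N.
have Oit i y : Om y -> Om (iter i g y) by exact: group_preserves (group_iter i Gg).
(* The [N + 1] iterates have exponents 0 to [N], so [x] drifts by at most [N * (2 * rho) <= 1]; with
   [d a x < D + 1] this gives the radius [D + 2]. *)
have [||i [j [ij dij]]] := @hilbert_ball_packing _ _ _ _ n0 oOm lineOm phi0 patchOm
    N.+1 M (D + 2) r x (fun i => iter i g a) M0 (ltnSn _) r0 Ox _ _ hDM.
- by move=> i; exact: Oit.
- move=> i; apply: le_lt_trans
    (dist_triangle Ox (Oit i _ Ox) (Oit i _ Oa)) _.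
  rewrite hilbert_dist_isometry //; last exact: group_iter.
  rewrite [d x a]dist_sym //.
  have : d x (iter i g x) <= 1.
    apply: le_trans (hilbert_dist_iter _ Gg Ox) _; apply: le_trans hrho.
    rewrite mulrC; apply: ler_pM => //; last by rewrite ler_nat -ltnS.
      by apply: (dist_ge0 Ox); exact: group_preserves.
    exact: ltW.
  lra.
have Gk := group_iter (j - i) Gg.
suff idk : iter (j - i) g = id.
  by apply: (torsion_free_iter (i := 0) Gg _ (esym idk)); rewrite subn_gt0.
apply: (embedded_ball_displacement eP Pa Oa Gk).
rewrite -(hilbert_dist_isometry (group_iter i Gg)) //; last exact: Oit.
by rewrite -iterD subnKC // ltnW.
Qed.
End Manifold.

(** The slack 1 comes from approximating the infimum; an element of [Ga] then carries the nearly
    optimal pair to one that ends at the prescribed lift [x]. *)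
Lemma quotient_dist_near (R : realType) (n : nat) (Om : set (RP R n)) Ga
    (p q : set (RP R n)) (x : RP R n) : (0 < n)%N ->
  properly_convex_manifold Om Ga ->
  quotient_points Om Ga p -> quotient_points Om Ga q -> q x ->
  exists a, [/\ p a, Om a & hilbert_dist Om a x < quotient_dist Om p q + 1].
Proof.
move=> n0 hM [a0 Oa0 pE] [b0 Ob0 qE] qx.
have [phi phi0 patchOm] := (pcm_convex hM).2.
have oOm := pcm_open hM; have lineOm := (pcm_convex hM).1.
have sub y z : Om y -> Defs.orbit Ga y z -> Om z.
  by move=> Oy [g Gg <-]; exact: (group_preserves hM).
pose S := [set hilbert_dist Om a b | a in p & b in q].
have hS : has_inf S.
  split.
    exists (hilbert_dist Om a0 b0), a0; first by rewrite -pE; exact: (orbit_refl hM).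
    by exists b0 => //; rewrite -qE; exact: (orbit_refl hM).
  exists 0 => _ [a pa [b qb <-]].
  apply: (hilbert_dist_ge0 n0 oOm lineOm phi0 patchOm).
    by apply: (sub a0); rewrite ?pE.
  by apply: (sub b0); rewrite ?qE.
have [_ [a pa [b qb <-]] lt] := inf_adherent (ltr01 : 0 < 1 :> R) hS.
have Oa : Om a by apply: (sub a0); rewrite ?pE.
have Ob : Om b by apply: (sub b0); rewrite ?qE.
have [g Gg gb] : Defs.orbit Ga b x.
  move: qb qx; rewrite -qE => -[h Gh <-].
  by rewrite (orbit_group hM _ Gh).
exists (g a); split; last by rewrite -gb (hilbert_dist_isometry n0 hM phi0 patchOm).
  rewrite -pE; have : Defs.orbit Ga a0 a by rewrite pE.
  move=> [h Gh ha]; exists (g \o h); first exact: pg_comp (pcm_group hM) _ _ Gg Gh.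
  by rewrite /= ha.
exact: (group_preserves hM).
Qed.

(** * The explicit bound *)

Section Bound.
Variables (R : realType) (n : nat).

(** A real number strictly below a positive [s], so that a supremum [s] yields an embedded ball of
    larger radius; 1 serves for an infinite injectivity radius. *)
Definition radius_below (s : \bar R) : R := if s is r%:E then r / 2 else 1.

(** The packing condition for a ball of radius [t + 2], solved for the number [M] of grid cells. *)
Definition cell_bound (s : \bar R) (t : R) : R :=
  2 * n.+1%:R * expR (t + 2) ^+ 2 / (expR (radius_below s / 4) - 1).

(** With [M] at most [cell_bound + 1], the power bounds the packing number. One factor 2 passes from
    radius to displacement; the other embeds a ball of twice this radius, which makes the final
    inequality strict. *)
Definition inj_bound (s : \bar R) (t : R) : R :=
  (4 * (cell_bound s t + 2) ^+ n.+1)^-1.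

Lemma radius_below_gt0 s : (0 < s)%E -> 0 < radius_below s.
Proof. by case: s => [r||] //=; rewrite lte_fin => r0; rewrite divr_gt0. Qed.

Lemma radius_below_lt s : (0 < s)%E -> ((radius_below s)%:E < s)%E.
Proof.
case: s => [r||] //=; rewrite ?lte_fin ?ltry // => r0.
by rewrite ltr_pdivrMr // ltr_pMr // ltr1n.
Qed.

Lemma cell_bound_den_gt0 s : (0 < s)%E -> 0 < expR (radius_below s / 4) - 1.
Proof.
by move=> /radius_below_gt0 r0; rewrite subr_gt0 expR_gt1 divr_gt0.
Qed.

Lemma cell_bound_gt0 s t : (0 < s)%E -> 0 < cell_bound s t.
Proof.
by move=> /cell_bound_den_gt0 ?; rewrite divr_gt0 // !mulr_gt0 ?exprn_gt0 ?expR_gt0.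
Qed.

Lemma inj_bound_gt0 s t : (0 < s)%E -> 0 < inj_bound s t.
Proof.
move=> /(cell_bound_gt0 t) c0; rewrite invr_gt0 mulr_gt0 // exprn_gt0 //.
by rewrite addr_gt0.
Qed.

Lemma inj_bound_decreasing s t t' : (0 < s)%E -> t < t' ->
  inj_bound s t' < inj_bound s t.
Proof.
move=> s0 tt; have c0 := cell_bound_gt0 t s0; have c0' := cell_bound_gt0 t' s0.
have P (c : R) : 0 < c -> 4 * (c + 2) ^+ n.+1 \is Num.pos.
  by move=> cp; rewrite posrE mulr_gt0 // exprn_gt0 // addr_gt0.
have Q (c : R) : 0 < c -> c + 2 \is Num.nneg.
  by move=> cp; rewrite nnegrE ltW // addr_gt0.
rewrite ltf_pV2 ?P // ltr_pM2l // ltr_pXn2r ?Q //.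
rewrite ltrD2r ltr_pM2r ?invr_gt0 ?cell_bound_den_gt0 //.
by rewrite ltr_pM2l ?mulr_gt0 // ltr_pXn2r ?nnegrE ?expR_ge0 // ltr_expR ltrD2r.
Qed.
End Bound.

Lemma inj_bound_lt_inj_radius (R : realType) (n : nat) (Om : set (RP R n)) Ga
    (p q : set (RP R n)) : (0 < n)%N -> properly_convex_manifold Om Ga ->
  quotient_points Om Ga p -> quotient_points Om Ga q ->
  ((inj_bound n (inj_radius Om Ga p) (quotient_dist Om p q))%:E
     < inj_radius Om Ga q)%E.
Proof.
move=> n0 hM pM qM; have [phi phi0 patchOm] := (pcm_convex hM).2.
have s0 : (0 < inj_radius Om Ga p)%E := inj_radius_gt0 n0 hM phi0 patchOm pM.
set s := inj_radius Om Ga p in s0 *; set D := quotient_dist Om p q.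
have r0 := radius_below_gt0 s0.
have [_ [r [_ eP] <-] sr] : exists2 t, [set r%:E | r in
    [set r : R | 0 < r /\ embedded_ball Om Ga p r]] t & ((radius_below s)%:E < t)%E.
  by apply: ereal_sup_gt; exact: radius_below_lt.
rewrite lte_fin in sr.
have b0 := inj_bound_gt0 n D s0; set rho := inj_bound n s D in b0 *.
have c0 := cell_bound_gt0 n D s0.
have den0 := cell_bound_den_gt0 s0.
suff eq : embedded_ball Om Ga q (2 * rho).
  apply: (@lt_le_trans _ _ (2 * rho)%:E); first by rewrite lte_fin ltr_pMl // ltr1n.
  by apply: ereal_sup_ubound; exists (2 * rho) => //; split; rewrite // mulr_gt0.
have qOm : q `<=` Om.
  by move: qM => [x Ox <-] _ [g Gg <-]; exact: (group_preserves hM).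
apply: (embedded_ball_of_displacement n0 hM phi0 patchOm qOm) => g x qx Gg dgx.
have [a [pa Oa dax]] := quotient_dist_near n0 hM pM qM qx.
(* The least integer above [cell_bound]: large enough for the packing, and at most [cell_bound + 1],
   as [inj_bound] assumes. *)
pose M := (Num.truncn (cell_bound n s D)).+1.
have Mr : 0 < M%:R :> R by rewrite ltr0n.
have cM : cell_bound n s D < M%:R by exact: truncnS_gt.
have Mc : M%:R <= cell_bound n s D + 1.
  by rewrite /M -natr1 lerD2r truncn_le // ltW.
apply: (small_displacement_trivial n0 hM phi0 patchOm eP (lt_trans r0 sr) pa Oa
  (qOm _ qx) Gg dax (ltn0Sn _) (M := M) _ _ dgx).
- apply: (@le_trans _ _ (expR (radius_below s / 4) - 1)).
    by rewrite ler_pdivrMr // -ler_pdivrMl // mulrC ltW.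
  by rewrite lerD2r ler_expR ler_pM2r ?invr_gt0 // ltW.
- set X : R := (cell_bound n s D + 2) ^+ n.+1.
  have X0 : 0 < X by rewrite exprn_gt0 // addr_gt0.
  have -> : 2 * (2 * rho) = X^-1 by rewrite /rho /inj_bound -/X; field; rewrite gt_eqF.
  rewrite mulrC ler_pdivrMr // mul1r natrX ler_pXn2r ?nnegrE //.
    by rewrite -natr1; lra.
  by rewrite ltW // addr_gt0.
Qed.

Unset Implicit Arguments.

Theorem proposition0p11 (R : realType) (n : nat) (hn : (2 <= n)%N) :
  exists f : \bar R -> R -> R,
    [/\ forall (s : \bar R) (d : R), (0 < s)%E -> 0 <= d -> 0 < f s d,
        forall (s : \bar R) (d d' : R),
          (0 < s)%E -> 0 <= d -> d < d' -> f s d' < f s d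
      & forall (Om : set (RP R n)) (Ga : set (RP R n -> RP R n)),
          properly_convex_manifold Om Ga ->
          forall p q : set (RP R n),
            quotient_points Om Ga p -> quotient_points Om Ga q ->
            ((f (inj_radius Om Ga p) (quotient_dist Om p q))%:E
               < inj_radius Om Ga q)%E].
Proof.
exists (inj_bound n); split=> [s d s0 _|s d d' s0 _|Om Ga hM p q].
- exact: inj_bound_gt0.
- exact: inj_bound_decreasing.
- by apply: inj_bound_lt_inj_radius => //; exact: ltnW.
Qed.
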